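(* Let $t\ge3$ and let $\nu$ be a $(t-1)$-wise uniform distribution on $\{0,1\}^k$. Consider a random $n$-variable, $m=\Delta n$-constraint, $k$-ary distributional CSP in which each constraint has a uniformly random scope of $k$ distinct variables and its distribution is $\nu$ up to a (random) negation pattern on the $k$ inputs. Suppose we also impose the following nonrandom distributional constraints: the ($0$-wise uniform) constraints $x_1=b_1,\dots,x_U=b_U$ for some string $b\in\{0,1\}^U$ with $U=O(\sqrt n)$; and, for each pair $(x_{U+1},x_{U+2}),(x_{U+3},x_{U+4}),\dots,(x_{n-1},x_n)$, the ($1$-wise uniform) constraint that the pair is uniformly distributed on $\{(0,1),(1,0)\}$. Then with high probability there is an SOS pseudodistribution of degree $D=\Omega\!\left(\frac{n}{\Delta^{2/(t-2)}\log\Delta}\right)$ that weakly satisfies all constraints.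
   Context: A distribution is $s$-wise uniform if all its marginals on $s$ coordinates are uniform. A distributional constraint is a pair $(S,\mu)$ of a scope $S$ (tuple of distinct variables) and a distribution $\mu$ on assignments to $S$. A degree-$D$ pseudodistribution (pseudoexpectation) over $\{0,1\}$-valued indeterminates is a linear functional $\widetilde{\mathbb{E}}$ on polynomials of degree $\le D$, respecting reduction mod $X_i^2=X_i$, with $\widetilde{\mathbb{E}}[1]=1$ and $\widetilde{\mathbb{E}}[Q^2]\ge0$ for $\deg Q\le D/2$. It weakly satisfies $(S,\mu)$ if it satisfies as an identity $\sum_{a\in\mathrm{supp}(\mu)}1_{X_S=a}=1$, i.e. $\widetilde{\mathbb{E}}[(\sum_{a\in\mathrm{supp}(\mu)}1_{X_S=a}-1)R]=0$ for all polynomials $R$ of appropriately bounded degree, where $1_{X_S=a}$ is the multilinear arithmetization of the indicator that $X_S=a$. *)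

(* Defs.v *)
From mathcomp Require Import all_boot all_order all_algebra.
From mathcomp Require Import mpoly.
From mathcomp Require Import boolp reals.

Set Implicit Arguments.
Unset Strict Implicit.
Unset Printing Implicit Defensive.

Import Order.TTheory GRing.Theory Num.Theory.

Local Open Scope ring_scope.

Record dist (R : realType) (k : nat) := Dist {
  pr :> k.-tuple bool -> R;
  pr_ge0 : forall x, 0 <= pr x;
  pr_sum1 : \sum_x pr x = 1 }.

(* Vacuous when s > k, since then no S has size s. *)
Definition wise_uniform (R : realType) (k s : nat) (mu : dist R k) :=
  forall (S : {set 'I_k}) (a : k.-tuple bool), #|S| = s ->
    \sum_(x : k.-tuple bool | [forall i in S, tnth x i == tnth a i]) mu x
      = (2 ^+ s)^-1.

Definition xor_tuple (k : nat) (z x : k.-tuple bool) : k.-tuple bool :=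
  [tuple tnth z i (+) tnth x i | i < k].

Lemma xor_tupleK k (z : k.-tuple bool) : involutive (xor_tuple z).
Proof. by move=> x; apply: eq_from_tnth => i; rewrite !tnth_mktuple addKb. Qed.

Section Distributions.
Variable R : realType.

Lemma negate_ge0 k (z : k.-tuple bool) (mu : dist R k) (x : k.-tuple bool) :
  0 <= mu (xor_tuple z x).
Proof. exact: pr_ge0. Qed.

Lemma negate_sum1 k (z : k.-tuple bool) (mu : dist R k) :
  \sum_x mu (xor_tuple z x) = 1.
Proof.
by rewrite -(pr_sum1 mu) [RHS](reindex_inj (inv_inj (xor_tupleK z))).
Qed.

Definition negate k (z : k.-tuple bool) (mu : dist R k) : dist R k :=
  Dist (negate_ge0 z mu) (negate_sum1 z mu).

Definition unif_fun k (A : {set k.-tuple bool}) (x : k.-tuple bool) : R :=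
  if x \in A then #|A|%:R^-1 else 0.

Lemma unif_fun_ge0 k (A : {set k.-tuple bool}) x : 0 <= unif_fun A x.
Proof. by rewrite /unif_fun; case: ifP => // _; rewrite invr_ge0 ler0n. Qed.

Lemma unif_fun_sum1 k (A : {set k.-tuple bool}) :
  A != set0 -> \sum_x unif_fun A x = 1.
Proof.
rewrite -card_gt0 => A_gt0; rewrite -big_mkcond sumr_const -[LHS]mulr_natr mulVf //.
by rewrite pnatr_eq0 -lt0n.
Qed.

Definition unif_dist k (A : {set k.-tuple bool}) (A_neq0 : A != set0) :
  dist R k := Dist (unif_fun_ge0 A) (unif_fun_sum1 A_neq0).

End Distributions.

Lemma point_neq0 (c : bool) : [set [tuple c]] != set0.
Proof. by apply/set0Pn; exists [tuple c]; rewrite set11. Qed.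

Lemma opposite_neq0 :
  [set [tuple false; true]; [tuple true; false]] != set0.
Proof. by apply/set0Pn; exists [tuple false; true]; rewrite set21. Qed.

Notation scope_of n k := {s : k.-tuple 'I_n | uniq s}.

Record dconstr (R : realType) (n : nat) := DConstr {
  arity : nat;
  scope : scope_of n arity;
  distr : dist R arity }.

Lemma uniq_pair n (i j : 'I_n) : i != j -> uniq [tuple i; j].
Proof. by rewrite /= inE andbT. Qed.

Definition unary_constr (R : realType) n (i : 'I_n) (c : bool) : dconstr R n :=
  DConstr (exist _ [tuple i] erefl : scope_of n 1)
          (unif_dist R (point_neq0 c)).

Definition opposite_constr (R : realType) n (i j : 'I_n) (neq_ij : i != j) :
    dconstr R n :=
  DConstr (exist _ [tuple i; j] (uniq_pair neq_ij) : scope_of n 2)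
          (unif_dist R opposite_neq0).

(* Variables are numbered from 0, so U <= i with i - U even enumerates the
   first elements of the pairs (U, U+1), (U+2, U+3), and so on. *)
Inductive imposed (R : realType) (n U : nat) (b : U.-tuple bool) :
    dconstr R n -> Prop :=
| ImposedFixed (i : 'I_n) :
    (i < U)%N -> imposed b (unary_constr R i (nth false b i))
| ImposedPair (i j : 'I_n) (neq_ij : i != j) :
    (U <= i)%N -> ~~ odd (i - U) -> j = i.+1 :> nat ->
    imposed b (opposite_constr R neq_ij).

Section Pseudodistributions.
Variables (R : realType) (n : nat).

(* msize is one plus the total degree (and 0 at the zero polynomial). *)
Definition deg_le (d : nat) (p : {mpoly R[n]}) := (msize p <= d.+1)%N.

(* Only the values of E on polynomials of degree at most D are meaningful. *)
Definition pseudodistribution (D : nat) (E : {mpoly R[n]} -> R) :=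
  [/\ forall (a : R) (p q : {mpoly R[n]}), deg_le D p -> deg_le D q ->
        E (a *: p + q) = a * E p + E q,
      forall (i : 'I_n) (p : {mpoly R[n]}), deg_le D (('X_i ^+ 2 - 'X_i) * p) ->
        E (('X_i ^+ 2 - 'X_i) * p) = 0,
      E 1 = 1 &
      forall q : {mpoly R[n]}, deg_le D./2 q -> 0 <= E (q ^+ 2)].

Definition indicator k (s : k.-tuple 'I_n) (a : k.-tuple bool) : {mpoly R[n]} :=
  \prod_(i < k) (if tnth a i then 'X_(tnth s i) else 1 - 'X_(tnth s i)).

Definition support_poly (c : dconstr R n) : {mpoly R[n]} :=
  \sum_(a | distr c a != 0) indicator (val (scope c)) a.

Definition weakly_satisfies (D : nat) (E : {mpoly R[n]} -> R) (c : dconstr R n) :=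
  forall p : {mpoly R[n]}, deg_le D ((support_poly c - 1) * p) ->
    E ((support_poly c - 1) * p) = 0.

End Pseudodistributions.

Notation instance n m k := {ffun 'I_m -> scope_of n k * k.-tuple bool}.

Definition random_constr (R : realType) n m k (nu : dist R k)
    (I : instance n m k) (j : 'I_m) : dconstr R n :=
  DConstr (I j).1 (negate (I j).2 nu).

Definition has_weak_pseudodistribution (R : realType) n m k U (D : nat)
    (nu : dist R k) (I : instance n m k) (b : U.-tuple bool) :=
  exists E : {mpoly R[n]} -> R,
    [/\ pseudodistribution D E,
        forall j : 'I_m, weakly_satisfies D E (random_constr nu I j) &
        forall c : dconstr R n, imposed b c -> weakly_satisfies D E c].

(* Probability of P for a uniformly random element of T; on a type of
   functions, the values are thus independent and uniform. *)
Definition unif_prob (R : realType) (T : finType) (P : T -> Prop) : R :=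
  #|[pred x | `[< P x >]]|%:R / #|T|%:R.

(* Main.v *)
Require Import Defs.
From mathcomp Require Import all_boot all_order all_algebra.
From mathcomp Require Import mpoly boolp reals sequences exp.
From mathcomp Require Import zify ring lra.

Set Implicit Arguments.
Unset Strict Implicit.
Unset Printing Implicit Defensive.

Import Order.TTheory GRing.Theory Num.Theory.

Local Open Scope ring_scope.

(** The imposed constraints are eliminated by substitution: x_i becomes a constant
   for i < U, and each pair becomes (y, 1 - y).  A polynomial is then a function on
   the cube of the y's, and the pseudoexpectation is given by its values M(S) on the
   characters chi_S.

   For a set H of constraints let E_H be the expectation against the product of the
   densities of H.  For a set S of variables, core S is the largest small minimiser
   of the submodular potential pot S F = 2 |V(F) u S| + nfix F - (2k - t) |F|, where
   V(F) is the set of variables of F and nfix F counts the slots filled by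
   constants; put region S = V(core S) u S and M(S) = E_(core S)[chi_S].  By
   (t-1)-wise uniformity only Fourier terms using at least t slots of a constraint
   matter, and maximality of core S shows that such terms with boundary in region S
   live inside core S, so that all the expectations E_H with H containing core S
   agree on region S.

   Positivity is a Gram-Schmidt argument on the degree.  Subtract from chi_S its
   projection on the characters of degree < |S| in region S; the same counting shows
   that the residual is orthogonal to every chi_T with |T| <= |S|, unless T has size
   |S| and lies in region S.  Hence residuals of equal degree interact only when they
   have the same core and region, and there the form is a true expectation.

   The expansion pot 0 F >= zeta |F| for |F| <= P ~ n / Delta^(2/(t-2)), with zeta of
   order 1 / ln Delta, holds with high probability by a union bound on exponential
   moments; the degree obtained is of order zeta P. *)

(** * Characters of the cube *)

Section Fourier.
Variable V : finType.

Definition symd (A B : {set V}) : {set V} := [set v | (v \in A) (+) (v \in B)].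

Lemma symdC A B : symd A B = symd B A.
Proof. by apply/setP => v; rewrite !inE addbC. Qed.

Lemma symdK A : involutive (symd A).
Proof. by move=> B; apply/setP => v; rewrite !inE addKb. Qed.

Lemma symd0 A : symd A set0 = A.
Proof. by apply/setP => v; rewrite !inE addbF. Qed.

Lemma symd_eq0 A B : (symd A B == set0) = (A == B).
Proof.
apply/eqP/eqP => [|->]; last by apply/setP => v; rewrite !inE addbb.
by move=> AB0; rewrite -[B](symdK A) AB0 symd0.
Qed.

Lemma symd_sub (A B C : {set V}) : A \subset C -> B \subset C -> symd A B \subset C.
Proof.
move=> /subsetP sAC /subsetP sBC; apply/subsetP => v; rewrite inE.
by have [/sAC|_] := boolP (v \in A) => //= /sBC.
Qed.

Lemma card_symd A B : (#|symd A B| <= #|A| + #|B|)%N.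
Proof.
apply: leq_trans (leq_card_setU A B); apply/subset_leq_card/subsetP => v.
by rewrite !inE; case: (v \in A).
Qed.

Variable R : realFieldType.

(** Points of the cube are encoded as subsets [y] of [V], so points and characters live in one group
    under [symd] and [chi] is symmetric. *)
Definition chi (A y : {set V}) : R := \prod_v (-1) ^+ ((v \in A) && (v \in y)).

Lemma chiC A y : chi A y = chi y A.
Proof. by apply: eq_bigr => v _; rewrite andbC. Qed.

Lemma chi0 y : chi set0 y = 1.
Proof. by apply: big1 => v _; rewrite inE. Qed.

Lemma chi1 v y : chi [set v] y = (-1) ^+ (v \in y).
Proof.
by rewrite /chi (bigD1 v) //= big1 ?mulr1 ?set11 // => u /negPf; rewrite inE => ->.
Qed.

Lemma chiM A B y : chi (symd A B) y = chi A y * chi B y.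
Proof.
rewrite /chi -big_split; apply: eq_bigr => v _.
by rewrite inE; case: (v \in A); case: (v \in B); case: (v \in y);
  rewrite /= ?expr0 ?expr1 ?mulrNN ?mulr1 ?mul1r.
Qed.

Definition avg (f : {set V} -> R) : R := #|{: {set V}}|%:R^-1 * \sum_y f y.

Lemma card_setV_neq0 : #|{: {set V}}|%:R != 0 :> R.
Proof. by rewrite pnatr_eq0 -lt0n; apply/card_gt0P; exists set0. Qed.

Lemma eq_avg f g : f =1 g -> avg f = avg g.
Proof. by move=> fg; congr (_ * _); apply: eq_bigr => y _; rewrite fg. Qed.

Lemma avg_sum (I : finType) (P : pred I) (f : I -> {set V} -> R) :
  avg (fun y => \sum_(i | P i) f i y) = \sum_(i | P i) avg (f i).
Proof. by rewrite /avg exchange_big mulr_sumr. Qed.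

Lemma avgZ a f : avg (fun y => a * f y) = a * avg f.
Proof. by rewrite /avg -mulr_sumr mulrCA. Qed.

Lemma avgD f g : avg (fun y => f y + g y) = avg f + avg g.
Proof. by rewrite /avg big_split mulrDr. Qed.

Lemma avg_ge0 f : (forall y, 0 <= f y) -> 0 <= avg f.
Proof. by move=> f0; rewrite mulr_ge0 ?invr_ge0 ?ler0n // sumr_ge0. Qed.

Lemma avg1 : avg (fun=> 1) = 1.
Proof. by rewrite /avg sumr_const mulVf ?card_setV_neq0. Qed.

Lemma avg_chi A : avg (chi A) = (A == set0)%:R.
Proof.
have [->|/set0Pn[v vA]] := eqVneq A set0; first by rewrite (eq_avg chi0) avg1.
(* Flipping a coordinate [v] of [A] permutes the cube and changes the sign of the character. *)
suff: avg (chi A) = - avg (chi A) by rewrite /=; lra.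
rewrite -mulN1r -avgZ /avg; congr (_ * _).
rewrite (reindex_inj (inv_inj (symdK [set v]))) /=; apply: eq_bigr => y _.
by rewrite chiC chiM chi1 vA expr1 [chi y A]chiC.
Qed.

Definition hat f A := avg (fun y => f y * chi A y).

Lemma fourier_inversion f y : f y = \sum_A hat f A * chi A y.
Proof.
have sum_chi z : \sum_A chi A z * chi A y = #|{: {set V}}|%:R * (z == y)%:R.
  rewrite -symd_eq0 -avg_chi /avg mulrA divff ?card_setV_neq0 // mul1r.
  by apply: eq_bigr => A _; rewrite 2!(chiC A) -chiM.
transitivity (#|{: {set V}}|%:R^-1 * \sum_z f z * \sum_A chi A z * chi A y).
  rewrite (bigD1 y) //= [X in _ + X]big1 => [|z /negPf zy]; last by rewrite sum_chi zy !mulr0.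
  by rewrite addr0 sum_chi eqxx mulr1 mulrCA mulVf ?mulr1 ?card_setV_neq0.
under [RHS]eq_bigr => A _ do rewrite /hat /avg -mulrA mulr_suml.
rewrite -mulr_sumr exchange_big; congr (_ * _); apply: eq_bigr => z _.
by rewrite mulr_sumr; apply: eq_bigr => A _; rewrite mulrA.
Qed.

Lemma hat_chi A B : hat (chi A) B = (A == B)%:R.
Proof. by rewrite -symd_eq0 -avg_chi; apply: eq_avg => y; rewrite chiM. Qed.

Lemma eq_hat f g A : f =1 g -> hat f A = hat g A.
Proof. by move=> fg; apply: eq_avg => y; rewrite fg. Qed.

Lemma hat_sum (I : finType) (P : pred I) (f : I -> {set V} -> R) A :
  hat (fun y => \sum_(i | P i) f i y) A = \sum_(i | P i) hat (f i) A.
Proof. by rewrite /hat -avg_sum; apply: eq_avg => y; rewrite mulr_suml. Qed.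

Lemma hatZ a f A : hat (fun y => a * f y) A = a * hat f A.
Proof. by rewrite /hat -avgZ; apply: eq_avg => y; rewrite mulrA. Qed.

Lemma hatD f g A : hat (fun y => f y + g y) A = hat f A + hat g A.
Proof. by rewrite /hat -avgD; apply: eq_avg => y; rewrite mulrDl. Qed.

Lemma hat_mulchi f B A : hat (fun y => f y * chi B y) A = hat f (symd A B).
Proof. by apply: eq_avg => y; rewrite chiM mulrA mulrAC. Qed.

Lemma hatM f g A : hat (fun y => f y * g y) A = \sum_B hat f B * hat g (symd B A).
Proof.
transitivity (hat (fun y => \sum_B hat f B * (g y * chi B y)) A).
  apply: eq_hat => y; rewrite {1}(fourier_inversion f y) mulr_suml.
  by apply: eq_bigr => B _; rewrite -mulrA [chi B y * _]mulrC.
rewrite hat_sum; apply: eq_bigr => B _.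
by rewrite hatZ hat_mulchi symdC.
Qed.

(** Degree is measured on functions on the cube, where it survives the substitution that eliminates
    the imposed constraints. *)
Definition hat_deg d f := forall A : {set V}, (d < #|A|)%N -> hat f A = 0.

Lemma hat_deg_chi (A : {set V}) : hat_deg #|A| (chi A).
Proof.
by move=> B ltAB; rewrite hat_chi; case: eqP ltAB => // ->; rewrite ltnn.
Qed.

Lemma hat_deg_cst a : hat_deg 0 (fun=> a).
Proof.
move=> A A_gt0; rewrite /hat avgZ avg_chi.
by case: eqP A_gt0 => [->|_]; rewrite ?cards0 ?mulr0.
Qed.

Lemma hat_degD d f g : hat_deg d f -> hat_deg d g -> hat_deg d (fun y => f y + g y).
Proof. by move=> df dg A ltdA; rewrite hatD df ?dg ?addr0. Qed.

Lemma hat_deg_sum (I : eqType) (r : seq I) d (f : I -> {set V} -> R) :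
  {in r, forall i, hat_deg d (f i)} -> hat_deg d (fun y => \sum_(i <- r) f i y).
Proof.
elim: r => [|i r IHr] df A dA.
  by rewrite (@eq_hat _ (fun=> 0)) => [|y]; rewrite ?big_nil // (hat_deg_cst 0) //; lia.
rewrite (@eq_hat _ (fun y => f i y + \sum_(j <- r) f j y)) => [|y].
  by apply: hat_degD dA; [apply: df|apply: IHr => j jr; apply: df];
    rewrite inE ?eqxx ?jr ?orbT.
by rewrite big_cons.
Qed.

Lemma hat_degZ d a f : hat_deg d f -> hat_deg d (fun y => a * f y).
Proof. by move=> df A ltdA; rewrite hatZ df ?mulr0. Qed.

Lemma hat_degW d e f : (d <= e)%N -> hat_deg d f -> hat_deg e f.
Proof. by move=> led df A /(leq_ltn_trans led)/df. Qed.

Lemma hat_degM d e f g :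
  hat_deg d f -> hat_deg e g -> hat_deg (d + e) (fun y => f y * g y).
Proof.
move=> df dg A ltA; rewrite hatM big1 // => B _.
have [/df ->|leB] := ltnP d #|B|; first by rewrite mul0r.
rewrite dg ?mulr0 //; have := card_symd B (symd B A); rewrite symdK; lia.
Qed.

Lemma hat_degX d f n : hat_deg d f -> hat_deg (n * d) (fun y => f y ^+ n).
Proof.
move=> df; elim: n => [|n IHn]; first exact: hat_deg_cst.
move=> A ltA; rewrite (@eq_hat _ (fun y => f y * f y ^+ n)); last first.
  by move=> y; rewrite exprS.
by apply: (hat_degM df IHn); rewrite -mulSn.
Qed.

Lemma hat_deg_prod (I : eqType) (r : seq I) (d : I -> nat) (f : I -> {set V} -> R) :
  (forall i, hat_deg (d i) (f i)) ->
  hat_deg (\sum_(i <- r) d i) (fun y => \prod_(i <- r) f i y).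
Proof.
move=> df; elim: r => [|i r IHr] A.
  rewrite (@eq_hat _ (fun=> 1)) => [|y]; last by rewrite big_nil.
  by rewrite big_nil; exact: hat_deg_cst.
rewrite (@eq_hat _ (fun y => f i y * \prod_(j <- r) f j y)) => [|y].
  by rewrite big_cons; exact: hat_degM.
by rewrite big_cons.
Qed.

End Fourier.

(** * Orthogonal projection for a possibly degenerate weight *)

Section Projection.
Variables (R : realFieldType) (Y I : finType) (w : Y -> R) (a : I -> Y -> R).
Hypothesis w_ge0 : forall y, 0 <= w y.

Let lin (c : I -> R) y := \sum_i c i * a i y.
Let dot (f g : Y -> R) := \sum_y w y * f y * g y.

Let dot_lin f (c : I -> R) : dot f (lin c) = \sum_i c i * dot f (a i).
Proof.
rewrite /dot /lin; under eq_bigr => y _ do rewrite mulr_sumr.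
rewrite exchange_big; apply: eq_bigr => i _; rewrite mulr_sumr.
by apply: eq_bigr => y _; ring.
Qed.

Let dotBr f g h : dot f (fun y => g y - h y) = dot f g - dot f h.
Proof. by rewrite /dot -sumrB; apply: eq_bigr => y _; ring. Qed.

Let dotBZl f g h b : dot (fun y => f y - b * g y) h = dot f h - b * dot g h.
Proof. by rewrite /dot mulr_sumr -sumrB; apply: eq_bigr => y _; ring. Qed.

(** Gram-Schmidt by induction on [r]: [u] is the part of the new vector orthogonal to the earlier
    ones, and [v'] is corrected by its component along [u]. *)
Lemma orthogonal_projection (v : Y -> R) (r : seq I) :
  exists2 c : I -> R, (forall i, i \notin r -> c i = 0) &
    forall i, i \in r -> \sum_y w y * (v y - \sum_j c j * a j y) * a i y = 0.
Proof.
elim: r v => [|i r IHr] v; first by exists (fun=> 0).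
have [c c0 v_orth] := IHr v; have [e e0 u_orth] := IHr (a i).
pose v' y := v y - lin c y; pose u y := a i y - lin e y.
have orth_u (f : Y -> R) : (forall j, j \in r -> dot f (a j) = 0) ->
    dot f u = dot f (a i).
  move=> f_orth; rewrite dotBr dot_lin big1 ?subr0 // => j _.
  by have [/f_orth ->|/e0 ->] := boolP (j \in r); rewrite ?mulr0 ?mul0r.
(* The form is only semidefinite. If [u] has norm zero, then [w y * u y] vanishes at every point, so
   the new vector adds no condition. *)
have [uu0|uu_neq0] := eqVneq (dot u u) 0.
  exists c => [j|j]; first by rewrite inE negb_or => /andP[_ /c0].
  rewrite inE => /predU1P[->|/v_orth//]; rewrite -[LHS](orth_u v') //.
  have wu0 y : w y * u y = 0.
    have wuu_ge0 z : true -> 0 <= w z * u z * u z.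
      by rewrite -mulrA mulr_ge0 // -expr2 sqr_ge0.
    have /eqP := @psumr_eq0P _ _ predT _ wuu_ge0 uu0 y isT.
    rewrite mulf_eq0 => /orP[/eqP//|/eqP->]; last by rewrite mulr0.
  by apply: big1 => y _; rewrite mulrAC wu0 mul0r.
pose b := dot v' u / dot u u.
have vE y : v y - \sum_j (c j + b * ((j == i)%:R - e j)) * a j y = v' y - b * u y.
  rewrite /v' /u /lin; under eq_bigr => j _ do rewrite mulrDl.
  rewrite big_split /= opprD addrA; congr (_ - _).
  rewrite mulrBr mulr_sumr; under eq_bigr => j _ do rewrite mulrBr mulrBl.
  rewrite sumrB; congr (_ - _); last by apply: eq_bigr => j _; rewrite mulrA.
  rewrite (bigD1 i) //= big1 => [|j /negPf ->]; first by rewrite eqxx mulr1 addr0.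
  by rewrite mulr0 mul0r.
exists (fun j => c j + b * ((j == i)%:R - e j)) => [j|j].
  by rewrite inE negb_or => /andP[/negPf-> jr]; rewrite c0 // e0 // subrr mulr0 addr0.
move=> j_ir; under eq_bigr => y _ do rewrite vE.
have orth_r l : l \in r -> dot (fun y => v' y - b * u y) (a l) = 0.
  by move=> lr; rewrite dotBZl [dot v' _]v_orth // [dot u _]u_orth // mulr0 subrr.
move: j_ir; rewrite inE => /predU1P[->|/orth_r//].
by rewrite -[LHS]orth_u // dotBZl /b divfK ?subrr.
Qed.

End Projection.

(** * Constraint graphs and their potential *)

Section ConstraintGraph.
Variables (V J : finType) (k t : nat) (slot : J -> 'I_k -> option V).

Implicit Types (F G H : {set J}) (S T W : {set V}) (A B : {set 'I_k}).

(** One constraint may read the same variable in several slots, since both members of a pair reduce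
    to one variable. Hence multiplicities, whose parity decides the character. *)
Definition mult j (A : {set 'I_k}) v : nat := \sum_(i in A) (slot j i == Some v).

Definition bd j A := [set v | odd (mult j A v)].

Definition slots (F : {set J}) v := (\sum_(j in F) mult j setT v)%N.

Definition cover F := [set v | (0 < slots F v)%N].

Definition nfix (F : {set J}) : nat := \sum_(j in F) \sum_i (slot j i == None).

(* The term (2k - t) |F| is split to avoid truncated subtraction. *)
Definition pot (S : {set V}) (F : {set J}) : int :=
  (2 * #|cover F :|: S| + nfix F + t * #|F|)%N%:Z - (2 * k * #|F|)%N%:Z.

Lemma mult_subset j (A B : {set 'I_k}) v :
  A \subset B -> (mult j A v <= mult j B v)%N.
Proof.
move=> /subsetP sAB; rewrite /mult [leqLHS]big_mkcond [leqRHS]big_mkcond.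
by apply: leq_sum => i _; have [/sAB ->|] := boolP (i \in A).
Qed.

Lemma sum_mult j A :
  (\sum_v mult j A v + \sum_(i in A) (slot j i == None) = #|A|)%N.
Proof.
rewrite exchange_big -big_split -sum1_card; apply: eq_bigr => i _ /=.
case: (slot j i) => [u|]; last by rewrite big1.
rewrite addn0 (bigD1 u) //= eqxx big1 // => v /negPf; rewrite eq_sym => uv.
by apply/eqP; rewrite eqb0; apply/negP => /eqP[/eqP]; rewrite uv.
Qed.

Lemma mem_cover F v :
  reflect (exists2 j, j \in F & (0 < mult j setT v)%N) (v \in cover F).
Proof.
rewrite inE lt0n sum_nat_eq0 negb_forall.
apply: (iffP existsP) => [[j]|[j jF j0]].
  by rewrite negb_imply -lt0n => /andP[]; exists j.
by exists j; rewrite jF -lt0n.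
Qed.

Lemma coverU F G : cover (F :|: G) = cover F :|: cover G.
Proof.
apply/setP => v; rewrite in_setU; apply/mem_cover/orP => [[j]|].
  by rewrite inE => /orP[] jF j0; [left|right]; apply/mem_cover; exists j.
by case=> /mem_cover[j jF j0]; exists j => //; rewrite inE jF ?orbT.
Qed.

Lemma coverS F G : F \subset G -> cover F \subset cover G.
Proof. by move=> /setUidPr <-; rewrite coverU subsetUl. Qed.

Lemma bd_sub_cover j A F : j \in F -> bd j A \subset cover F.
Proof.
move=> jF; apply/subsetP => v; rewrite inE => /odd_gt0 m0.
by apply/mem_cover; exists j => //; rewrite (leq_trans m0) ?mult_subset ?subsetT.
Qed.

Lemma card_cover F : (#|cover F| <= k * #|F|)%N.
Proof.
rewrite mulnC -sum_nat_const; apply: (@leq_trans (\sum_v slots F v)).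
  by rewrite -sum1_card big_mkcond; apply: leq_sum => v _; rewrite inE; case: ifP.
rewrite exchange_big; apply: leq_sum => j _ /=.
have := sum_mult j setT; rewrite cardsT card_ord; lia.
Qed.

Lemma sum_setUI (m : J -> nat) (F G : {set J}) :
  (\sum_(j in F :|: G) m j + \sum_(j in F :&: G) m j =
   \sum_(j in F) m j + \sum_(j in G) m j)%N.
Proof.
rewrite ![(\sum_(_ in _) _)%N]big_mkcond -!big_split; apply: eq_bigr => j _.
by rewrite !inE; case: (j \in F); case: (j \in G); rewrite /= ?addn0.
Qed.

Lemma pot_set0 S : pot S set0 = (2 * #|S|)%N%:Z.
Proof.
rewrite /pot cards0 !muln0 /nfix big_set0 !addn0 subr0; congr (2 * _)%N%:Z.
apply: eq_card => v; rewrite !inE; case: (v \in S); rewrite ?orbT // orbF.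
by rewrite /slots big_set0.
Qed.

Lemma pot_setS S T F : S \subset T -> pot S F <= pot T F.
Proof.
by move=> sST; rewrite /pot; have := subset_leq_card (setUS (cover F) sST); lia.
Qed.

(** Coverage is submodular, while [nfix] and cardinality are modular. Allowing different base sets
    also yields monotonicity of cores. *)
Lemma pot_submodular S T F G : S \subset T ->
  pot T (F :|: G) + pot S (F :&: G) <= pot T F + pot S G.
Proof.
move=> sST; rewrite /pot.
have := sum_setUI (fun j => \sum_i (slot j i == None))%N F G.
rewrite -/(nfix F) -/(nfix G) -/(nfix (F :&: G)) -/(nfix (F :|: G)).
have := cardsUI F G; have := cardsUI (cover F :|: T) (cover G :|: S).
have -> : (cover F :|: T) :|: (cover G :|: S) = cover (F :|: G) :|: T.
  rewrite coverU; apply/setP => v; have /subsetP/(_ v) := sST; rewrite !inE.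
  by case: (v \in S) => [->//|_]; rewrite ?orbT ?orbF // orbAC.
have /subset_leq_card : cover (F :&: G) :|: S
    \subset (cover F :|: T) :&: (cover G :|: S).
  by rewrite subsetI !setUSS // coverS ?subsetIl ?subsetIr.
nia.
Qed.

(** * Families: one set of slots per constraint, indexing the Fourier terms of a product density *)

Notation family := {ffun J -> {set 'I_k}}.

Implicit Type phi : family.

Definition fsupp phi := [set j | phi j != set0].

Definition fmult phi v := (\sum_j mult j (phi j) v)%N.

(** The product of the characters of the [bd j (phi j)] is the character of [fbd phi], as even
    multiplicities cancel. *)
Definition fbd phi := [set v | odd (fmult phi v)].

Definition restr (H : {set J}) phi : family :=
  [ffun j => if j \in H then phi j else set0].

Lemma mult0 j v : mult j set0 v = 0%N. Proof. by rewrite /mult big_set0. Qed.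

Lemma fmult_fsupp phi v : fmult phi v = (\sum_(j in fsupp phi) mult j (phi j) v)%N.
Proof.
rewrite [RHS]big_mkcond; apply: eq_bigr => j _; rewrite inE.
by case: eqP => // ->; rewrite mult0.
Qed.

Lemma fmult_le phi v : (fmult phi v <= slots (fsupp phi) v)%N.
Proof. by rewrite fmult_fsupp; apply: leq_sum => j _; rewrite mult_subset ?subsetT. Qed.

Lemma fbd_sub phi F : fsupp phi \subset F -> fbd phi \subset cover F.
Proof.
move=> /coverS; apply: subset_trans; apply/subsetP => v; rewrite !inE.
by move=> /odd_gt0 m0; exact: leq_trans m0 (fmult_le phi v).
Qed.

Lemma fsupp_restr H phi : fsupp (restr H phi) = fsupp phi :&: H.
Proof. by apply/setP => j; rewrite !inE ffunE; case: ifP; rewrite ?eqxx ?andbT ?andbF. Qed.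

Lemma fbd_restrC H phi v : v \notin cover H ->
  (v \in fbd (restr (~: H) phi)) = (v \in fbd phi).
Proof.
move=> vH; rewrite !inE; congr (odd _); apply: eq_bigr => j _.
rewrite ffunE inE; have [jH|//] := boolP (j \in H); rewrite mult0.
apply/esym/eqP; rewrite -leqn0 leqNgt; apply: contra vH => m0.
by apply/mem_cover; exists j => //; rewrite (leq_trans m0) ?mult_subset ?subsetT.
Qed.

(* At a vertex with D slots, d of them in phi, the claim reads
   2 [D > 0] + d <= 2 D + [d odd] outside W and [d odd] + d <= 2 D inside W. *)
Lemma family_count phi (W : {set V}) :
  (forall j, j \in fsupp phi -> t <= #|phi j|)%N ->
  let G := fsupp phi in
  (2 * #|cover G :\: W| + nfix G + #|fbd phi :&: W| + t * #|G|
    <= 2 * k * #|G| + #|fbd phi :\: W|)%N.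
Proof.
move=> t_le; set G := fsupp phi; rewrite /=.
have slotsE : (\sum_v slots G v + nfix G = k * #|G|)%N.
  rewrite exchange_big -big_split /= mulnC -sum_nat_const; apply: eq_bigr => j _.
  rewrite -[RHS]card_ord -cardsT -(sum_mult j setT); congr (_ + _)%N.
  by apply: eq_bigl => i; rewrite inE.
have fmultE : (t * #|G| <= \sum_v fmult phi v + nfix G)%N.
  under eq_bigr => v _ do rewrite fmult_fsupp.
  rewrite exchange_big -big_split /= mulnC -sum_nat_const; apply: leq_sum => j jG.
  apply: leq_trans (t_le j jG) _; rewrite -(sum_mult j) leq_add2l [leqLHS]big_mkcond.
  by apply: leq_sum => i _; case: ifP.
have cardE (X : {set V}) : #|X| = (\sum_v (v \in X))%N.
  by rewrite -sum1_card big_mkcond; apply: eq_bigr => v _; case: ifP.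
suff : (\sum_v ((v \in cover G :\: W) + (v \in cover G :\: W)
      + (v \in fbd phi :&: W) + fmult phi v)
    <= \sum_v (slots G v + slots G v + (v \in fbd phi :\: W)))%N.
  by rewrite !big_split /= -!cardE; nia.
apply: leq_sum => v _; have := fmult_le phi v; rewrite -/G !inE.
case: (v \in W) => /=; case: (boolP (odd (fmult phi v))) => od /=; lia.
Qed.

End ConstraintGraph.

(** * Pseudomoments of expanding instances *)

Section PseudoMoments.
Variables (R : realFieldType) (V J : finType) (k t : nat).
Variables (slot : J -> 'I_k -> option V) (w : J -> {set V} -> R).
Variable c : J -> {set 'I_k} -> R.

Notation bd := (bd slot).
Notation cover := (cover slot).
Notation pot := (pot t slot).
Notation fbd := (fbd slot).
Notation family := {ffun J -> {set 'I_k}}.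
Notation chi := (@chi V R).

Implicit Types (F G H : {set J}) (S T W : {set V}) (A B : {set 'I_k}).
Implicit Type phi : family.

Hypothesis w_ge0 : forall j y, 0 <= w j y.
Hypothesis w_expand : forall j y, w j y = \sum_A c j A * chi (bd j A) y.
Hypothesis c0 : forall j, c j set0 = 1.
Hypothesis c_small : forall j A, (0 < #|A| < t)%N -> c j A = 0.

Definition dens H y := \prod_(j in H) w j y.

Definition wt phi := \prod_j c j (phi j).

Lemma dens_ge0 H y : 0 <= dens H y.
Proof. by apply: prodr_ge0 => j _; exact: w_ge0. Qed.

(** By [c_small], only such families carry a nonzero weight. *)
Definition valid phi := forall j, j \in fsupp phi -> (t <= #|phi j|)%N.

Lemma wt_valid phi : wt phi != 0 -> valid phi.
Proof.
move=> wt_neq0 j; rewrite inE -card_gt0 => phi_gt0; rewrite leqNgt.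
apply: contra wt_neq0 => phi_lt; rewrite /wt (bigD1 j) //= c_small ?mul0r //.
by rewrite phi_gt0.
Qed.

Lemma chi_fbd phi y : chi (fbd phi) y = \prod_j chi (bd j (phi j)) y.
Proof.
rewrite /chi exchange_big; apply: eq_bigr => v _ /=.
rewrite inE; under [RHS]eq_bigr => j _ do rewrite inE.
case: (v \in y); last by rewrite andbF big1 // => j _; rewrite andbF.
rewrite andbT signr_odd /fmult -prodrXr; apply: eq_bigr => j _.
by rewrite andbT signr_odd.
Qed.

Lemma bd0 j : bd j set0 = set0.
Proof. by apply/setP => v; rewrite !inE mult0. Qed.

Lemma dens_expand H y :
  dens H y = \sum_(phi : family | fsupp phi \subset H) wt phi * chi (fbd phi) y.
Proof.
rewrite /dens; under eq_bigr => j _ do rewrite w_expand.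
rewrite (big_distr_big_dep set0); apply: eq_big => [phi|phi].
  apply/pfamilyP/idP => [[/subsetP sub _]|/subsetP sub].
    by apply/subsetP => j; rewrite inE => /sub.
  by split=> //; apply/subsetP => j jn; apply: sub; rewrite inE.
move=> /pfamilyP[/subsetP sub _]; rewrite chi_fbd /wt -big_split /= big_mkcond.
apply: eq_bigr => j _; case: ifP => // jH.
have -> : phi j = set0 by apply: contraFeq jH => jn; apply: (sub j); rewrite inE.
by rewrite c0 bd0 chi0 mulr1.
Qed.

Definition EH H f := avg (fun y => f y * dens H y).

Lemma eq_EH H f g : f =1 g -> EH H f = EH H g.
Proof. by move=> fg; apply: eq_avg => y; rewrite fg. Qed.

Lemma EH_sum (I : finType) (P : pred I) H (f : I -> {set V} -> R) :
  EH H (fun y => \sum_(i | P i) f i y) = \sum_(i | P i) EH H (f i).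
Proof. by rewrite /EH -avg_sum; apply: eq_avg => y; rewrite mulr_suml. Qed.

Lemma EHZ H a f : EH H (fun y => a * f y) = a * EH H f.
Proof. by rewrite /EH -avgZ; apply: eq_avg => y; rewrite mulrA. Qed.

Lemma EH_chi H S :
  EH H (chi S) = \sum_(phi : family | (fsupp phi \subset H) && (fbd phi == S)) wt phi.
Proof.
rewrite /EH.
transitivity (avg (fun y => \sum_(phi : family | fsupp phi \subset H)
                              wt phi * chi (symd (fbd phi) S) y)).
  apply: eq_avg => y; rewrite dens_expand mulr_sumr; apply: eq_bigr => phi _.
  by rewrite chiM; ring.
rewrite avg_sum [RHS]big_mkcondr; apply: eq_bigr => phi _.
by rewrite avgZ avg_chi symd_eq0; case: eqP; rewrite ?mulr1 ?mulr0.
Qed.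

Lemma EH_chi_out H S : ~~ (S \subset cover H) -> EH H (chi S) = 0.
Proof.
move=> SH; rewrite EH_chi big1 // => phi /andP[/fbd_sub sub /eqP phiS].
by move: SH; rewrite -phiS sub.
Qed.

(** * Cores, regions and local consistency of the moments *)

Variables (P Q D : nat) (zeta : R).

(** Expansion holds up to size [P]. It forces sets of potential at most [2 * D] down to size [Q],
    and [2 * Q <= P] keeps the union of two cores within the expanding range. *)
Hypothesis zeta_gt0 : 0 < zeta.
Hypothesis expanding : forall F, (#|F| <= P)%N -> zeta * #|F|%:R <= (pot set0 F)%:~R.
Hypothesis Q_large : (2 * D)%:R < zeta * Q.+1%:R.
Hypothesis Q2_le : (2 * Q <= P)%N.
Hypothesis Q_lt : (Q < P)%N.

(** The factor [P.+1] exceeds any cardinality in range, so the potential is compared first and the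
    size only breaks ties. *)
Definition score S F : int := P.+1%:Z * pot S F - #|F|%:Z.

(* Subtracting #|F| selects the largest among the minimisers of pot S. *)
Definition core S : {set J} :=
  [arg min_(F < set0 | (#|F| <= P)%N) score S F]%O.

Definition region S := cover (core S) :|: S.

Lemma coreP S :
  (#|core S| <= P)%N /\ forall F, (#|F| <= P)%N -> score S (core S) <= score S F.
Proof. by rewrite /core; case: arg_minP => [|F FP minF]; rewrite ?cards0. Qed.

Lemma core_min S F : (#|F| <= P)%N -> pot S (core S) <= pot S F.
Proof.
have [NP minN] := coreP S; move=> FP; have := minN _ FP; rewrite /score; nia.
Qed.

(** The union with [G] would be a minimiser too, and the tie-break forbids a larger one. *)
Lemma core_max S G : (#|core S :|: G| <= P)%N ->
  pot S (core S :|: G) <= pot S (core S) -> G \subset core S.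
Proof.
move=> NGP leNG; have [_ /(_ _ NGP)] := coreP S; rewrite /score => sc.
apply/setUidPl/esym/eqP; rewrite eqEcard subsetUl /=; nia.
Qed.

Lemma small_card S F : (#|S| <= D)%N -> (#|F| <= P)%N ->
  pot S F <= (2 * #|S|)%N%:Z -> (#|F| <= Q)%N.
Proof.
move=> SD FP potF; rewrite -ltnS -(ltr_nat R) -(ltr_pM2l zeta_gt0).
apply: le_lt_trans Q_large; apply: le_trans (expanding FP) _.
rewrite -[leRHS]mulrz_nat -[(2 * D)%:R]/(((2 * D)%N%:Z)%:~R) ler_int.
have := pot_setS t slot F (sub0set S); lia.
Qed.

Lemma core_le S : (#|S| <= D)%N -> (#|core S| <= Q)%N.
Proof.
move=> SD; have [NP _] := coreP S; apply: (@small_card S) => //.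
by rewrite -(pot_set0 t slot) core_min ?cards0.
Qed.

(** By submodularity and minimality of [core S], adding [core S] to [core T] does not raise [pot T];
    maximality then absorbs it. *)
Lemma core_mono S T : S \subset T -> (#|T| <= D)%N -> core S \subset core T.
Proof.
move=> sST TD; have SD : (#|S| <= D)%N := leq_trans (subset_leq_card sST) TD.
have leP : (#|core T :|: core S| <= P)%N.
  by have := core_le SD; have := core_le TD; rewrite cardsU; lia.
apply: core_max => //; have := pot_submodular t slot (core T) (core S) sST.
have /(core_min S) : (#|core T :&: core S| <= P)%N.
  by have := subset_leq_card (subsetIl (core T) (core S)); have := core_le TD; lia.
lia.
Qed.

Lemma region_mono S T : S \subset T -> (#|T| <= D)%N -> region S \subset region T.
Proof. by move=> sST TD; rewrite setUSS // coverS // core_mono. Qed.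

(** Otherwise [family_count] with [W := region S] shows that adding [fsupp phi] to the core does not
    raise the potential, contradicting maximality. *)
Lemma boundary_drop S phi : (#|S| <= D)%N -> valid phi ->
  [disjoint core S & fsupp phi] -> (#|core S :|: fsupp phi| <= P)%N ->
  fsupp phi != set0 ->
  (#|fbd phi :&: region S| < #|fbd phi :\: region S|)%N.
Proof.
move=> SD phiv disj leP; apply: contraNltn => le_bd.
set G := fsupp phi in disj leP *.
suff sGN : G \subset core S.
  by rewrite -subset0 -(setIidPr sGN); move: disj; rewrite -setI_eq0 => /eqP->.
apply: core_max => //; have := family_count slot (region S) phiv.
rewrite -/G /pot coverU -setUA (setUC (cover G)) setUA -/(region S).
have -> : #|region S :|: cover G| = (#|region S| + #|cover G :\: region S|)%N.
  rewrite cardsU cardsD setIC.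
  by have := subset_leq_card (subsetIl (cover G) (region S)); lia.
rewrite cardsU; move: disj; rewrite -setI_eq0 => /eqP disj; rewrite disj cards0.
have -> : nfix slot (core S :|: G) = (nfix slot (core S) + nfix slot G)%N.
  have := sum_setUI (fun j => \sum_i (slot j i == None))%N (core S) G.
  by rewrite disj big_set0 addn0.
nia.
Qed.

(** Discarding the part of [phi] inside the core changes the boundary only on [cover (core S)]. What
    remains has no boundary outside the region, which [boundary_drop] forbids unless it is empty. *)
Lemma family_in_core S phi : (#|S| <= D)%N -> valid phi ->
  (#|core S :|: fsupp phi| <= P)%N -> fbd phi \subset region S ->
  fsupp phi \subset core S.
Proof.
move=> SD phiv leP /subsetP sub; pose psi := restr (~: core S) phi.
have suppE : fsupp psi = fsupp phi :\: core S by rewrite fsupp_restr setDE.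
apply/subsetP => j j_phi; apply: contraT => j_core.
suff : (#|fbd psi :&: region S| < #|fbd psi :\: region S|)%N.
  suff -> : fbd psi :\: region S = set0 by rewrite cards0 ltn0.
  apply/eqP; rewrite setD_eq0; apply/subsetP => v.
  have [/(subsetP (subsetUl _ S))//|vN] := boolP (v \in cover (core S)).
  by rewrite fbd_restrC // => /sub.
apply: boundary_drop => //.
- move=> i; rewrite suppE !inE => /andP[iN i_phi]; rewrite ffunE inE iN.
  by apply: phiv; rewrite inE.
- rewrite suppE -setI_eq0; apply/eqP/setP => i.
  by rewrite !inE; case: (i \in core S).
- apply: leq_trans leP; apply/subset_leq_card.
  by rewrite suppE setUS ?subsetDl.
- by apply/set0Pn; exists j; rewrite suppE inE j_core.
Qed.

(** Both sides sum the same families: those with boundary [T] and nonzero weight already live in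
    [core S]. *)
Lemma EH_core S H T : (#|S| <= D)%N -> core S \subset H -> (#|H| <= P)%N ->
  T \subset region S -> EH H (chi T) = EH (core S) (chi T).
Proof.
move=> SD sNH HP TS; rewrite !EH_chi [LHS]big_mkcond [RHS]big_mkcond.
apply: eq_bigr => phi _.
have [->|/wt_valid phiv] := eqVneq (wt phi) 0; first by rewrite !if_same.
have [bdT|] := eqVneq (fbd phi) T; last by rewrite !andbF.
rewrite !andbT; suff -> : (fsupp phi \subset H) = (fsupp phi \subset core S) by [].
apply/idP/idP => [sH|/subset_trans->//]; apply: family_in_core; rewrite ?bdT //.
by apply: leq_trans HP; rewrite subset_leq_card // subUset sNH.
Qed.

Definition moment S := EH (core S) (chi S).

(** Both expectations agree with the one over [core S :|: core T]. *)
Lemma moment_local S T : (#|S| <= D)%N -> (#|T| <= D)%N -> T \subset region S ->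
  moment T = EH (core S) (chi T).
Proof.
move=> SD TD TS; have leP : (#|core S :|: core T| <= P)%N.
  by have := core_le SD; have := core_le TD; rewrite cardsU; lia.
rewrite -(@EH_core S (core S :|: core T)) ?subsetUl // /moment.
by rewrite (@EH_core T) ?subsetUr.
Qed.

Lemma core0 : core set0 = set0.
Proof.
have [NP _] := coreP set0; apply/eqP; rewrite -cards_eq0 -leqn0 leqNgt.
apply/negP => N_gt0; have := expanding NP.
have : pot set0 (core set0) <= 0.
  by rewrite (le_trans (core_min _ (F := set0) _)) ?cards0 // pot_set0 cards0.
rewrite -(ler_int R) => le0 /le_trans/(_ le0); apply/negP; rewrite -ltNge.
by rewrite mulr_gt0 // ltr0n.
Qed.

Lemma moment0 : moment set0 = 1.
Proof.
rewrite /moment core0 -[RHS](avg1 V R); apply: eq_avg => y.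
by rewrite chi0 /dens big_set0 mulr1.
Qed.

(** Adding all variables of [j] to [T] gives one set whose region contains every character involved.
    All moments are then expectations over an [H] containing [j], and the density of [j] vanishes
    wherever the combination does not. *)
Lemma moment_constraint j T (g : {set 'I_k} -> R) : (#|T| + k <= D)%N ->
  (forall y, w j y != 0 -> \sum_A g A * chi (bd j A) y = 0) ->
  \sum_A g A * moment (symd (bd j A) T) = 0.
Proof.
move=> TkD g0; pose S := T :|: cover [set j]; pose H := j |: core S.
have SD : (#|S| <= D)%N.
  by rewrite cardsU; have := card_cover slot [set j]; rewrite cards1; lia.
have HP : (#|H| <= P)%N by rewrite cardsU1; have := core_le SD; case: (j \in _); lia.
have sub A : symd (bd j A) T \subset S.
  by rewrite symd_sub ?subsetUl // (subset_trans (bd_sub_cover _ _ (set11 j))) ?subsetUr.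
transitivity (EH H (fun y => \sum_A g A * chi (symd (bd j A) T) y)).
  rewrite EH_sum; apply: eq_bigr => A _; rewrite EHZ; congr (_ * _).
  rewrite (@moment_local S) ?(leq_trans (subset_leq_card (sub A))) //.
    rewrite (@EH_core S) ?subsetUr // (subset_trans (sub A)) ?subsetUr //.
  by rewrite (subset_trans (sub A)) ?subsetUr.
rewrite /EH /avg big1 ?mulr0 // => y _.
rewrite /dens (bigD1 j) ?setU11 //= mulrA.
under eq_bigr => A _ do rewrite chiM mulrA.
rewrite -mulr_suml; have [->|/g0->] := eqVneq (w j y) 0; last by rewrite !mul0r.
by rewrite mulr0 mul0r.
Qed.

(** * Residuals and positivity of the moment form *)

Definition lin (f : {set V} -> R) y := \sum_T f T * chi T y.

(** Here [f] lists the coefficients of [chi S] minus its projection on lower-degree characters of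
    the region; its only coefficient in degree at least [#|S|] is the leading one. *)
Definition residual_spec S (f : {set V} -> R) :=
  [/\ forall T, (#|S| <= #|T|)%N -> f T = (T == S)%:R,
      forall T, f T != 0 -> T \subset region S &
      forall T, T \subset region S -> (#|T| < #|S|)%N ->
        EH (core S) (fun y => lin f y * chi T y) = 0].

Lemma residual_exists S : exists f, residual_spec S f.
Proof.
pose r := [seq T : {set V} <- enum {: {set V}} | (T \subset region S) && (#|T| < #|S|)%N].
have mem_r T : (T \in r) = (T \subset region S) && (#|T| < #|S|)%N.
  by rewrite mem_filter mem_enum andbT.
have [e e0 orth] := orthogonal_projection chi (dens_ge0 (core S)) (chi S) r.
pose f T := (T == S)%:R - e T.
have linE y : lin f y = chi S y - \sum_T e T * chi T y.
  rewrite /lin; under eq_bigr => T _ do rewrite mulrBl.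
  rewrite sumrB; congr (_ - _); rewrite (bigD1 S) //= big1 => [|T /negPf->].
    by rewrite eqxx mul1r addr0.
  by rewrite mul0r.
exists f; split=> [T ST|T|T TS Tlt].
- by rewrite /f e0 ?subr0 // mem_r negb_and -leqNgt ST orbT.
- rewrite /f; have [->|TS] := eqVneq T S; first by rewrite subsetUr.
  rewrite sub0r oppr_eq0; have [Tr _|/e0->] := boolP (T \in r); last by rewrite eqxx.
  by move: Tr; rewrite mem_r => /andP[].
- have /orth : T \in r by rewrite mem_r TS.
  move=> o; rewrite /EH /avg (_ : \sum_y _ = 0) ?mulr0 // -[RHS]o.
  by apply: eq_bigr => y _; rewrite linE; ring.
Qed.

Lemma residual_card S f T : residual_spec S f -> f T != 0 -> (#|T| <= #|S|)%N.
Proof.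
case=> fS _ _ fT; rewrite leqNgt; apply: contra fT => ST.
by rewrite fS ?(ltnW ST) //; case: (eqVneq T S) ST => [->|]; rewrite ?ltnn ?eqxx.
Qed.

Lemma EH_lin_chi H f T :
  EH H (fun y => lin f y * chi T y) = \sum_B f B * EH H (chi (symd B T)).
Proof.
under [RHS]eq_bigr => B _ do rewrite -EHZ.
rewrite -EH_sum; apply: eq_EH => y; rewrite /lin mulr_suml.
by apply: eq_bigr => B _; rewrite chiM mulrA.
Qed.

(* Expand the density of the constraints added to core S: each term multiplies chi_T
   by a character whose product with it either leaves region S, and then averages to
   zero, or has degree < |S| by boundary_drop, and then is orthogonal to the residual. *)
Lemma residual_orth_far S f T : (2 * #|S| <= D)%N -> (#|T| <= #|S|)%N ->
  residual_spec S f -> ~~ (T \subset region S) ->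
  \sum_B f B * moment (symd B T) = 0.
Proof.
move=> SD TS fS Tout; have [_ f_sub f_orth] := fS.
have UD : (#|S :|: T| <= D)%N by rewrite cardsU; lia.
have sub : region S \subset region (S :|: T) by rewrite region_mono ?subsetUl.
pose N' := core (S :|: T); have sNN' : core S \subset N' by rewrite core_mono ?subsetUl.
transitivity (EH N' (fun y => lin f y * chi T y)).
  rewrite EH_lin_chi; apply: eq_bigr => B _.
  have [->|fB] := eqVneq (f B) 0; first by rewrite !mul0r.
  rewrite (@moment_local (S :|: T)) //.
    by have := card_symd B T; have := residual_card fS fB; lia.
  rewrite symd_sub ?(subset_trans (f_sub B fB)) //.
  by rewrite subsetU // subsetUr orbT.
transitivity (\sum_(phi : family | fsupp phi \subset N' :\: core S)
    wt phi * EH (core S) (fun y => lin f y * chi (symd T (fbd phi)) y)).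
  under [RHS]eq_bigr => phi _ do rewrite -EHZ.
  rewrite -EH_sum; apply: eq_avg => y.
  have -> : dens N' y = dens (core S) y * dens (N' :\: core S) y.
    rewrite /dens (big_setID (core S)) /= (setIidPr sNN') //.
  rewrite (dens_expand (N' :\: core S)) mulrA mulr_sumr [RHS]mulr_suml; apply: eq_bigr => phi _.
  by rewrite chiM; ring.
apply: big1 => phi phi_sub.
have [->|/wt_valid phiv] := eqVneq (wt phi) 0; first by rewrite mul0r.
set X := symd T (fbd phi).
have [XS|XS] := boolP (X \subset region S); last first.
  rewrite EH_lin_chi big1 ?mulr0 // => B _.
  have [->|fB] := eqVneq (f B) 0; first by rewrite mul0r.
  rewrite EH_chi_out ?mulr0 //; apply: contra XS => /subset_trans sub_reg.
  rewrite -(symdK B X) symd_sub ?(f_sub B fB) // sub_reg //.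
  exact: subsetUl.
rewrite f_orth ?mulr0 //.
(* Since [X] stays in the region, [fbd phi] must cancel [T] outside it. *)
have mem_bd v : v \notin region S -> (v \in fbd phi) = (v \in T).
  move=> vS; have : v \notin X by apply: contra vS => /(subsetP XS).
  by rewrite !inE; case: (v \in T) => /= [/negPn|/negPf].
have bdD : fbd phi :\: region S = T :\: region S.
  apply/setP => v; rewrite inE [RHS]inE.
  by have [//|/mem_bd->] := boolP (v \in region S).
have : (#|fbd phi :&: region S| < #|fbd phi :\: region S|)%N.
  apply: boundary_drop => //; first by lia.
  - by rewrite -setI_eq0 setIC setI_eq0; move: phi_sub; rewrite subsetD => /andP[].
  - apply: (@leq_trans #|N'|); last by have := core_le UD; rewrite -/N'; lia.
    rewrite subset_leq_card // subUset sNN' (subset_trans phi_sub) //.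
    exact: subsetDl.
  - apply: contra Tout => /eqP phi0; rewrite -setD_eq0 -bdD.
    rewrite (_ : fbd phi = set0) ?set0D //.
    apply/eqP; rewrite -subset0 (subset_trans (@fbd_sub _ _ _ slot phi set0 _)) ?phi0 //.
    by apply/subsetP => v /mem_cover[j]; rewrite inE.
(* Passing from [T] to [X] trades the part of [T] outside the region for at most the strictly
   smaller boundary inside, so [X] has degree below that of [T]. *)
rewrite bdD => lt_bd; apply: leq_trans TS.
rewrite -(cardsID (region S) T); apply: leq_ltn_trans (_ : #|T :&: region S| + _ < _)%N; last first.
  by rewrite ltn_add2l; exact: lt_bd.
apply: leq_trans (card_symd _ _); apply: subset_leq_card; apply/subsetP => v vX.
by move: (vX) (subsetP XS v vX); rewrite !inE => + ->; rewrite !andbT.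
Qed.

Lemma residual_orth S f T : (2 * #|S| <= D)%N -> (#|T| <= #|S|)%N ->
  residual_spec S f -> ~~ ((T \subset region S) && (#|T| == #|S|)) ->
  \sum_B f B * moment (symd B T) = 0.
Proof.
move=> SD TS fS; rewrite negb_and => /orP[/residual_orth_far->//|TnS].
have [TR|/residual_orth_far->//] := boolP (T \subset region S).
have Tlt : (#|T| < #|S|)%N by rewrite ltn_neqAle TnS.
have [_ f_sub f_orth] := fS; rewrite -[RHS](f_orth T) // EH_lin_chi.
apply: eq_bigr => B _; have [->|fB] := eqVneq (f B) 0; first by rewrite !mul0r.
rewrite (@moment_local S) ?symd_sub ?(f_sub B fB) //; first lia.
by have := card_symd B T; have := residual_card fS fB; lia.
Qed.

Definition form (f g : {set V} -> R) := \sum_S \sum_T f S * g T * moment (symd S T).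

Lemma formC f g : form f g = form g f.
Proof.
rewrite /form exchange_big; apply: eq_bigr => S _; apply: eq_bigr => T _.
by rewrite symdC mulrAC mulrC mulrA mulrC.
Qed.

Lemma formE f g : form f g = \sum_T g T * \sum_S f S * moment (symd S T).
Proof.
rewrite /form exchange_big; apply: eq_bigr => T _; rewrite mulr_sumr.
by apply: eq_bigr => S _; ring.
Qed.

(* Each of S and T lies in the region of the other, so that core T also minimises
   pot S and conversely. *)
Lemma form_residuals S T f g : (2 * #|S| <= D)%N -> #|T| = #|S| ->
  residual_spec S f -> residual_spec T g ->
  form f g != 0 -> (core T, region T) = (core S, region S).
Proof.
move=> SD TS fS gT.
(* All characters of [g'] have degree at most [#|A|], and only [B] reaches it. If [B] leaves the
   region of [A], each is orthogonal to [f']. *)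
have half (A B : {set V}) f' g' : (2 * #|A| <= D)%N -> #|B| = #|A| ->
    residual_spec A f' -> residual_spec B g' -> form f' g' != 0 -> B \subset region A.
  move=> AD BA fA gB; apply: contraR => Bout; rewrite formE; apply/eqP/big1 => C _.
  have [->|gC] := eqVneq (g' C) 0; first by rewrite mul0r.
  have CA : (#|C| <= #|A|)%N by rewrite -BA (residual_card gB gC).
  rewrite (residual_orth _ _ fA) ?mulr0 //; apply: contra Bout => /andP[CR /eqP CA'].
  have [gB1 _ _] := gB; move: gC; rewrite gB1 ?CA' ?BA //.
  by have [<-|_] := eqVneq C B; rewrite ?eqxx.
move=> fg; have TR : T \subset region S by exact: half fg.
have SR : S \subset region T by apply: (half T S g f); rewrite ?TS // formC.
(* [A] adds no vertex beyond the region of [B], so changing the base from [B] to [A] cannot increase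
   the potential of [core B]. *)
have pot_le (A B : {set V}) : A \subset region B -> pot A (core B) <= pot B (core B).
  move=> AB; rewrite /pot lerD2r lez_nat !leq_add2r leq_mul2l /=.
  by rewrite subset_leq_card // subUset subsetUl.
have core_sub (A B : {set V}) : (#|A| <= D)%N -> #|B| = #|A| ->
    A \subset region B -> B \subset region A ->
    core B \subset core A.
  move=> AD BA AB BAr.
  have leP : (#|core A :|: core B| <= P)%N.
    by have := @core_le A; have := @core_le B; rewrite cardsU BA; lia.
  apply: core_max => //; have := pot_submodular t slot (core A) (core B) (subxx A).
  have /(core_min A) : (#|core A :&: core B| <= P)%N.
    by have := subset_leq_card (subsetIl (core A) (core B)); have := core_le AD; lia.
  have := pot_le _ _ AB; have := pot_le _ _ BAr.
  have [NP _] := coreP A; have := core_min B NP; lia.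
have cST : core T = core S.
  by apply/eqP; rewrite eqEsubset !core_sub ?TS //; lia.
congr (_, _) => //; apply/eqP; rewrite eqEsubset /region cST !subUset !subsetUl /=.
by rewrite -{1}/(region S) TR -cST -/(region T).
Qed.

Lemma formDl f g h : form (fun S => f S + g S) h = form f h + form g h.
Proof.
rewrite -big_split; apply: eq_bigr => S _; rewrite -big_split.
by apply: eq_bigr => T _; rewrite /=; ring.
Qed.

Lemma formDr f g h : form f (fun S => g S + h S) = form f g + form f h.
Proof. by rewrite formC formDl !(formC f). Qed.

Lemma form_suml (I : finType) (p : pred I) (a : I -> R) (f : I -> {set V} -> R) h :
  form (fun S => \sum_(i | p i) a i * f i S) h = \sum_(i | p i) a i * form (f i) h.
Proof.
under [RHS]eq_bigr => i _ do rewrite mulr_sumr.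
rewrite exchange_big; apply: eq_bigr => S _.
under [RHS]eq_bigr => i _ do rewrite mulr_sumr.
rewrite exchange_big; apply: eq_bigr => T _; rewrite !mulr_suml.
by apply: eq_bigr => i _; ring.
Qed.

Lemma form_local S f g : (#|S| <= D)%N ->
  (forall B T : {set V}, f B != 0 -> g T != 0 -> (#|symd B T| <= D)%N) ->
  (forall T, f T != 0 -> T \subset region S) ->
  (forall T, g T != 0 -> T \subset region S) ->
  form f g = EH (core S) (fun y => lin f y * lin g y).
Proof.
move=> SD cardD f_sub g_sub; rewrite formE.
transitivity (EH (core S) (fun y => \sum_T g T * (lin f y * chi T y))); last first.
  by apply: eq_EH => y; rewrite mulr_sumr; apply: eq_bigr => T _; ring.
rewrite EH_sum; apply: eq_bigr => T _; rewrite EHZ EH_lin_chi.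
have [->|gT] := eqVneq (g T) 0; first by rewrite !mul0r.
congr (_ * _); apply: eq_bigr => B _.
have [->|fB] := eqVneq (f B) 0; first by rewrite !mul0r.
by rewrite (@moment_local S) ?cardD ?symd_sub ?(f_sub B) ?(g_sub T).
Qed.

(** The form is block diagonal in the pair (core, region), and each block is the expectation of a
    square under one genuine density. *)
Lemma form_residuals_ge0 n (q : {set V} -> R) (psi : {set V} -> {set V} -> R) :
  (2 * n <= D)%N -> (forall S, residual_spec S (psi S)) ->
  0 <= \sum_(S : {set V} | #|S| == n) \sum_(T : {set V} | #|T| == n)
         q S * q T * form (psi S) (psi T).
Proof.
move=> nD psiP; pose key S := (core S, region S).
rewrite (partition_big key xpredT) //=; apply: sumr_ge0 => -[N W] _.
have -> : \sum_(S : {set V} | (#|S| == n) && (key S == (N, W))) \sum_(T : {set V} | #|T| == n)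
      q S * q T * form (psi S) (psi T) =
    \sum_(S : {set V} | (#|S| == n) && (key S == (N, W)))
      \sum_(T : {set V} | (#|T| == n) && (key T == (N, W))) q S * q T * form (psi S) (psi T).
  apply: eq_bigr => S /andP[/eqP Sn /eqP keyS]; rewrite [RHS]big_mkcondr.
  apply: eq_bigr => T /eqP Tn; case: ifPn => // keyT.
  have [->|] := eqVneq (form (psi S) (psi T)) 0; first by rewrite mulr0.
  move=> /(form_residuals _ _ (psiP S) (psiP T)); rewrite Sn Tn => /(_ nD erefl).
  by rewrite -/(key T) -/(key S) keyS => /eqP; rewrite (negPf keyT).
have [S0|noS] := pickP (fun S : {set V} => (#|S| == n) && (key S == (N, W))); last first.
  by rewrite big_pred0.
move=> /andP[/eqP S0n /eqP keyS0].
have S0D : (#|S0| <= D)%N by lia.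
have -> : \sum_(S : {set V} | (#|S| == n) && (key S == (N, W)))
      \sum_(T : {set V} | (#|T| == n) && (key T == (N, W))) q S * q T * form (psi S) (psi T) =
    EH (core S0) (fun y => (\sum_(S : {set V} | (#|S| == n) && (key S == (N, W)))
                              q S * lin (psi S) y) ^+ 2).
  transitivity (EH (core S0) (fun y =>
      \sum_(S : {set V} | (#|S| == n) && (key S == (N, W)))
      \sum_(T : {set V} | (#|T| == n) && (key T == (N, W)))
        q S * q T * (lin (psi S) y * lin (psi T) y))); last first.
    apply: eq_EH => y; rewrite expr2 mulr_suml; apply: eq_bigr => S _.
    by rewrite mulr_sumr; apply: eq_bigr => T _; ring.
  rewrite EH_sum; apply: eq_bigr => S /andP[/eqP Sn /eqP keyS].
  rewrite EH_sum; apply: eq_bigr => T /andP[/eqP Tn /eqP keyT].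
  have regE U : key U = (N, W) -> region U = region S0.
    by move=> keyU; move: keyS0; rewrite -keyU => -[].
  rewrite EHZ (@form_local S0) // => [B C|B|B].
  - move=> /(residual_card (psiP S)) + /(residual_card (psiP T)).
    by have := card_symd B C; lia.
  - by have [_ sub _] := psiP S; rewrite -(regE S) //; exact: sub.
  - by have [_ sub _] := psiP T; rewrite -(regE T) //; exact: sub.
by apply: avg_ge0 => y; rewrite mulr_ge0 ?sqr_ge0 ?dens_ge0.
Qed.

(** Subtracting the combination [h] of residuals with the same leading coefficients lowers the
    degree. The rest is orthogonal to [h], and [form h h] is nonnegative. *)
Lemma form_reduce m (f : {set V} -> R) : (2 * m <= D)%N ->
  (forall S, (m < #|S|)%N -> f S = 0) ->
  exists2 g, (forall S, (m <= #|S|)%N -> g S = 0) & form g g <= form f f.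
Proof.
move=> mD f0; have [psi psiP] := fin_all_exists residual_exists.
pose h T := \sum_(S : {set V} | #|S| == m) f S * psi S T.
have hE T : (m <= #|T|)%N -> h T = f T.
  move=> mT; have [Tm|Tm] := eqVneq #|T| m.
    rewrite /h (bigD1 T) ?Tm //= big1 => [|S /andP[/eqP Sm ST]].
      by have [psiE _ _] := psiP T; rewrite psiE // eqxx mulr1 addr0.
    by have [psiE _ _] := psiP S; rewrite psiE ?Sm // eq_sym (negPf ST) mulr0.
  rewrite f0 ?ltn_neqAle 1?eq_sym ?Tm // /h big1 // => S /eqP Sm.
  have [psiE _ _] := psiP S; rewrite psiE ?Sm //.
  by have [TS|_] := eqVneq T S; [rewrite TS Sm eqxx in Tm | rewrite mulr0].
pose g T := f T - h T; exists g => [T /hE|]; first by rewrite /g => ->; rewrite subrr.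
have g_orth : form h g = 0.
  rewrite form_suml big1 // => S /eqP Sm; rewrite formE big1 ?mulr0 // => T _.
  have [Tm|mT] := ltnP #|T| m; last by rewrite /g hE ?subrr ?mul0r.
  rewrite (@residual_orth S) ?mulr0 ?Sm //; first exact: ltnW.
  by rewrite (ltn_eqF Tm) andbF.
have fE : form f f = form g g + form h h.
  have -> : form f f = form (fun T => g T + h T) (fun T => g T + h T).
    by rewrite /form; apply: eq_bigr => S _; apply: eq_bigr => T _; rewrite /g !subrK.
  by rewrite (formDl g h) !(formDr _ g h) (formC g h) g_orth addr0 add0r.
rewrite fE lerDl form_suml.
suff -> : \sum_(S : {set V} | #|S| == m) f S * form (psi S) h =
    \sum_(S : {set V} | #|S| == m) \sum_(T : {set V} | #|T| == m)
      f S * f T * form (psi S) (psi T) by exact: form_residuals_ge0.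
apply: eq_bigr => S _; rewrite formC form_suml mulr_sumr; apply: eq_bigr => T _.
by rewrite formC; ring.
Qed.

Lemma form_ge0 n (q : {set V} -> R) : (2 * n <= D)%N ->
  (forall S, (n < #|S|)%N -> q S = 0) -> 0 <= form q q.
Proof.
elim: n q => [|n IHn] q nD /(form_reduce nD)[g g0 le_gq]; apply: le_trans le_gq.
  by rewrite /form big1 // => S _; rewrite big1 // => T _; rewrite g0 ?mul0r.
by apply: IHn => //; lia.
Qed.

Theorem pseudo_moments : exists M : {set V} -> R,
  [/\ M set0 = 1,
      forall n (q : {set V} -> R), (2 * n <= D)%N ->
        (forall S, (n < #|S|)%N -> q S = 0) ->
        0 <= \sum_S \sum_T q S * q T * M (symd S T) &
      forall j T (g : {set 'I_k} -> R), (#|T| + k <= D)%N ->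
        (forall y, w j y != 0 -> \sum_A g A * chi (bd j A) y = 0) ->
        \sum_A g A * M (symd (bd j A) T) = 0].
Proof.
by exists moment; split; [exact: moment0 | exact: form_ge0 | exact: moment_constraint].
Qed.

End PseudoMoments.

(** * Random instances expand *)

Section Resampling.
Variables (R : realFieldType) (J T : finType) (j : J).

Definition resample (I : {ffun J -> T}) (x : T) : {ffun J -> T} :=
  [ffun i => if i == j then x else I i].

(** Swapping coordinate [j] of [I] with the fresh value [x] is an involution on pairs, and [f]
    ignores coordinate [j] of its first argument. *)
Lemma sum_resample (f : {ffun J -> T} -> T -> R) :
  (forall I x y, f (resample I y) x = f I x) ->
  #|T|%:R * (\sum_I f I (I j)) = \sum_I \sum_x f I x.
Proof.
move=> f_inv; pose s (u : {ffun J -> T} * T) := (resample u.1 u.2, u.1 j).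
have sK : involutive s.
  case=> I x; rewrite /s /= ffunE eqxx; congr (_, _).
  by apply/ffunP => i; rewrite !ffunE; case: eqP => [->|].
rewrite pair_big /= (reindex_inj (inv_inj sK)) /=.
under [RHS]eq_bigr => u _ do rewrite f_inv.
rewrite -(pair_big xpredT xpredT (fun I (x : T) => f I (I j))) /= mulr_sumr.
by apply: eq_bigr => I _; rewrite sumr_const mulr_natl.
Qed.

End Resampling.

(** * Exponential moment of the cost of one scope *)

Section SlotCost.
Variables (R : realFieldType) (X V : finType) (p : X -> option V).

Definition vars (s : seq X) := [set v | Some v \in map p s].

(* Read from left to right, a slot costs 2 if its variable is new, 1 if it is a
   constant and 0 if its variable is already covered. *)
Definition cost (s : seq X) (W : {set V}) : nat :=
  2 * #|vars s :\: W| + count (fun x => p x == None) s.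

Definition cost1 x (W : {set V}) : nat :=
  if p x is Some v then 2 * (v \notin W) else 1.

Definition grow x (W : {set V}) := if p x is Some v then v |: W else W.

Implicit Type W : {set V}.

Lemma cost_cons x s W : cost (x :: s) W = (cost1 x W + cost s (grow x W))%N.
Proof.
rewrite /cost /cost1 /grow /=; case px: (p x) => [v|] /=; last first.
  suff -> : vars (x :: s) = vars s by lia.
  by apply/setP => v; rewrite !inE px.
have -> : #|vars (x :: s) :\: W| = ((v \notin W) + #|vars s :\: (v |: W)|)%N.
  rewrite (cardsD1 v); congr (_ + _)%N; first by rewrite !inE px eqxx /= andbT.
  apply: eq_card => u; rewrite !inE px negb_or (inj_eq Some_inj).
  by case: eqP.
by rewrite add0n mulnDr addnA.
Qed.

Variables (U B : nat) (theta Z : R).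
Hypothesis theta_ge0 : 0 <= theta.
Hypothesis fixed_le : (#|[set x | p x == None]| <= U)%N.
Hypothesis fiber_le : forall v, (#|[set x | p x == Some v]| <= 2)%N.
Hypothesis Z_ge : U%:R * theta + (2 * B)%:R + #|X|%:R * theta ^+ 2 <= Z.

(** At most [U] positions are constants, at most [2 * #|W|] hit a covered variable, and all others
    cost 2. *)
Lemma sum_cost1_le W : (#|W| <= B)%N -> \sum_x theta ^+ cost1 x W <= Z.
Proof.
move=> WB; apply: le_trans Z_ge.
have -> : U%:R * theta + (2 * B)%:R + #|X|%:R * theta ^+ 2 =
   U%:R * theta + ((2 * B)%:R + #|X|%:R * theta ^+ 2) by ring.
apply: (@le_trans _ _ (\sum_x ((p x == None)%:R * theta +
   ((\sum_(v in W) (p x == Some v))%N%:R + theta ^+ 2)))).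
  apply: ler_sum => x _; rewrite /cost1; case: (p x) => [v|] /=.
    rewrite mul0r add0r; have [vW|vW] := boolP (v \in W); last first.
      by rewrite muln1 lerDr ler0n.
    rewrite muln0 expr0 (bigD1 v) //= eqxx natrD -addrA lerDl.
    by rewrite addr_ge0 ?ler0n ?sqr_ge0.
  by rewrite mul1r lerDl addr_ge0 ?ler0n ?sqr_ge0.
rewrite !big_split /= -mulr_suml -!natr_sum sumr_const -[theta ^+ 2 *+ _]mulr_natl.
rewrite lerD ?lerD2r //.
    rewrite ler_wpM2r // ler_nat; apply: leq_trans fixed_le.
  by rewrite -sum1dep_card [leqRHS]big_mkcond; apply: leq_sum => x _; case: eqP.
rewrite ler_nat exchange_big /= mulnC; apply: leq_trans (leq_mul WB (leqnn 2)).
rewrite -sum_nat_const; apply: leq_sum => v _; apply: leq_trans (fiber_le v).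
by rewrite -sum1dep_card [leqRHS]big_mkcond; apply: leq_sum => x _; case: eqP.
Qed.

Lemma sum_tuple_cons n (f : seq X -> R) :
  \sum_(s : n.+1.-tuple X) f s = \sum_x \sum_(s : n.-tuple X) f (x :: s).
Proof.
rewrite pair_big /= (reindex (fun u : X * n.-tuple X => [tuple of u.1 :: u.2])) //=.
exists (fun s : n.+1.-tuple X => (thead s, [tuple of behead s])) => [[x s] _|s _].
  by rewrite /= theadE; congr (_, _); apply: val_inj.
by rewrite /= -tuple_eta.
Qed.

(** The slots are summed in order; each adds at most one variable to [W], so the one-slot bound
    applies throughout. *)
Lemma sum_cost_le n W : (#|W| + n <= B)%N ->
  \sum_(s : n.-tuple X) theta ^+ cost s W <= Z ^+ n.
Proof.
have Z_ge0 : 0 <= Z.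
  by apply: le_trans Z_ge; rewrite !addr_ge0 ?mulr_ge0 ?ler0n ?sqr_ge0.
elim: n W => [|n IHn] W WnB.
  rewrite (big_pred1 [tuple]) => [|s]; last by rewrite [s]tuple0 /= eqxx.
  have vars0 : vars [::] = set0.
    by apply/setP => v; rewrite !inE.
  by rewrite /cost /= vars0 set0D cards0.
rewrite (sum_tuple_cons _ (fun s => theta ^+ cost s W)) exprS.
apply: (@le_trans _ _ (\sum_x theta ^+ cost1 x W * Z ^+ n)).
  apply: ler_sum => x _; under eq_bigr => s _ do rewrite cost_cons exprD.
  rewrite -mulr_sumr ler_wpM2l ?exprn_ge0 ?IHn // /grow.
  by case: (p x) => [v|]; [rewrite cardsU1; case: (v \in W)|]; lia.
rewrite -mulr_suml ler_wpM2r ?exprn_ge0 ?sum_cost1_le //; lia.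
Qed.

End SlotCost.

(** * Exponential moment for a set of constraints *)

Section RandomGraph.
Variables (R : realFieldType) (n m k : nat) (V N : finType) (p : 'I_n -> option V).

Notation constr := ({s : k.-tuple 'I_n | uniq s} * N)%type.
Notation inst := {ffun 'I_m -> constr}.

Implicit Types (I : inst) (F : {set 'I_m}).

Definition inst_slot I j i := p (tnth (val (I j).1) i).

(** This is the random part of [pot set0 F], which further contains only the deterministic
    [(t - 2k) |F|]. *)
Definition weight I F : nat := 2 * #|cover (inst_slot I) F| + nfix (inst_slot I) F.

Lemma cover_inst1 I j : cover (inst_slot I) [set j] = vars p (val (I j).1).
Proof.
apply/setP => v; rewrite [RHS]inE; apply/mem_cover/mapP.
  case=> i; rewrite inE => /eqP->; rewrite lt0n sum_nat_eq0 negb_forall.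
  case/existsP=> l; rewrite inE eqb0 negbK => /eqP lv.
  by exists (tnth (val (I j).1) l); rewrite ?mem_tnth.
case=> _ /tnthP[l ->] lv; exists j; rewrite ?set11 //.
rewrite lt0n sum_nat_eq0 negb_forall; apply/existsP; exists l.
by rewrite inE eqb0 negbK /inst_slot -lv.
Qed.

Lemma weightU1 I j F : j \notin F ->
  weight I (j |: F) = (weight I F + cost p (val (I j).1) (cover (inst_slot I) F))%N.
Proof.
move=> jF; rewrite /weight coverU cover_inst1 /cost /nfix big_setU1 //=.
have -> : (\sum_i (inst_slot I j i == None) = count (fun x => p x == None) (val (I j).1))%N.
  by rewrite -sum1_count big_tuple [RHS]big_mkcond; apply: eq_bigr => i _;
    rewrite /inst_slot; case: eqP.
set A := vars _ _; set W := cover _ _.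
have -> : #|A :|: W| = (#|W| + #|A :\: W|)%N.
  by rewrite cardsU cardsD; have := subset_leq_card (subsetIl A W); lia.
rewrite -[sval (I j).1]/(val (I j).1); ring.
Qed.

Lemma eq_slots I I' F v : {in F, I =1 I'} ->
  slots (inst_slot I) F v = slots (inst_slot I') F v.
Proof.
by move=> II'; apply: eq_bigr => j jF; apply: eq_bigr => i _; rewrite /inst_slot II'.
Qed.

Lemma eq_cover I I' F : {in F, I =1 I'} ->
  cover (inst_slot I) F = cover (inst_slot I') F.
Proof. by move=> II'; apply/setP => v; rewrite !inE (eq_slots _ II'). Qed.

Lemma eq_weight I I' F : {in F, I =1 I'} -> weight I F = weight I' F.
Proof.
move=> II'; rewrite /weight (eq_cover II'); congr (_ + _)%N.
by apply: eq_bigr => j jF; apply: eq_bigr => i _; rewrite /inst_slot II'.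
Qed.

Variables (U r : nat) (theta Z kap : R).
Hypothesis theta_ge0 : 0 <= theta.
Hypothesis fixed_le : (#|[set x | p x == None]| <= U)%N.
Hypothesis fiber_le : forall v, (#|[set x | p x == Some v]| <= 2)%N.
Hypothesis Z_ge : U%:R * theta + (2 * (k * r))%:R + #|'I_n|%:R * theta ^+ 2 <= Z.
Hypothesis kap_ge0 : 0 <= kap.
Hypothesis kap_ge : Z ^+ k <= kap * #|{: {s : k.-tuple 'I_n | uniq s}}|%:R.
Hypothesis constr_gt0 : (0 < #|{: constr}|)%N.

Lemma sum_cost_constr (W : {set V}) : (#|W| + k <= k * r)%N ->
  \sum_(x : constr) theta ^+ cost p (val x.1) W <= kap * #|{: constr}|%:R.
Proof.
move=> Wk; rewrite -(pair_big xpredT xpredT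
  (fun (s : {s : k.-tuple 'I_n | uniq s}) (x : N) => theta ^+ cost p (val s) W)) /=.
rewrite card_prod natrM mulrA; under eq_bigr => s _ do rewrite sumr_const -mulr_natr.
rewrite -mulr_suml ler_wpM2r ?ler0n //; apply: le_trans kap_ge.
apply: le_trans (sum_cost_le theta_ge0 fixed_le fiber_le Z_ge Wk).
(* Repeated entries are allowed in the scope, which only adds nonnegative terms; [kap_ge] pays for
   the change of normalisation. *)
rewrite [leRHS](bigID (fun s : k.-tuple 'I_n => uniq s)) /= -[leLHS]addr0 lerD //.
  rewrite [leRHS](reindex_omap (val : {s : k.-tuple 'I_n | uniq s} -> _) insub) /=.
    rewrite [leRHS](eq_bigl xpredT) // => s.
    by rewrite valK eqxx andbT; apply: (valP s).
  by move=> s us; rewrite insubT.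
by apply: sumr_ge0 => s _; rewrite exprn_ge0.
Qed.

(* The constraints of F are added one by one, the scope of the last one being
   resampled given the others. *)
Lemma sum_weight F : (#|F| <= r)%N ->
  \sum_I theta ^+ weight I F <= kap ^+ #|F| * #|{: inst}|%:R.
Proof.
move: {2}#|F| (erefl #|F|) => f; elim: f F => [|f IHf] F Ff Fr.
  have -> : F = set0 by apply/eqP; rewrite -cards_eq0 Ff.
  rewrite cards0 expr0 mul1r (eq_bigr (fun=> 1)) ?sumr_const // => I _.
  have -> : weight I set0 = 0%N; last by rewrite expr0.
  rewrite /weight /nfix big_set0 (_ : cover _ set0 = set0) ?cards0 //.
  by apply/setP => v; rewrite !inE /slots big_set0.
have /set0Pn[j jF] : F != set0 by rewrite -cards_eq0 Ff.
have FE := setD1K jF; set G := F :\ j in FE.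
have jG : j \notin G by rewrite !inE eqxx.
have Gf : #|G| = f by move: Ff; rewrite (cardsD1 j) jF => -[].
have agree I x : {in G, resample j I x =1 I}.
  by move=> i iG; rewrite ffunE; case: eqP iG jG => // -> ->.
pose h I (x : constr) := theta ^+ weight I G * theta ^+ cost p (val x.1) (cover (inst_slot I) G).
rewrite Ff -FE (eq_bigr (fun I => h I (I j))) => [|I _]; last by rewrite weightU1 // exprD.
rewrite -(ler_pM2l (_ : 0 < #|{: constr}|%:R)) ?ltr0n // sum_resample; last first.
  by move=> I x y; rewrite /h (eq_weight (agree I y)) (eq_cover (agree I y)).
apply: (@le_trans _ _ (\sum_I theta ^+ weight I G * (kap * #|{: constr}|%:R))).
  apply: ler_sum => I _; rewrite -mulr_sumr ler_wpM2l ?exprn_ge0 //.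
  apply: sum_cost_constr; have := card_cover (inst_slot I) G; rewrite Gf; nia.
rewrite -mulr_suml exprS; have IH := IHf G Gf; rewrite Gf in IH.
have fr : (f <= r)%N by lia.
have kc_ge0 : 0 <= kap * #|{: constr}|%:R by rewrite mulr_ge0 ?ler0n.
apply: le_trans (ler_wpM2r kc_ge0 (IH fr)) _.
by rewrite le_eqVlt; apply/orP; left; apply/eqP; ring.
Qed.

End RandomGraph.

(** * Counting estimates *)

Lemma ffact_le_expn m r : (m ^_ r <= m ^ r)%N.
Proof.
rewrite ffact_prod -[X in (_ <= _ ^ X)%N]card_ord -prod_nat_const.
by apply: leq_prod => i _; exact: leq_subr.
Qed.

Lemma expn_le_ffact m r d : (r + d <= m.+1)%N -> (d ^ r <= m ^_ r)%N.
Proof.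
move=> rdm; rewrite ffact_prod -[X in (_ ^ X <= _)%N]card_ord -prod_nat_const.
by apply: leq_prod => i _; have := ltn_ord i; lia.
Qed.

(** The bound [r ^ r <= 4 ^ r * r!] comes from the falling factorial of [2r], which equals [r!]
    times a central binomial coefficient. *)
Lemma binomial_le_expn m r : ('C(m, r) * r ^ r <= (4 * m) ^ r)%N.
Proof.
have rr : (r ^ r <= 4 ^ r * r`!)%N.
  apply: (@leq_trans ((r + r) ^_ r)); first by apply: expn_le_ffact; lia.
  rewrite -bin_ffact leq_mul2r; apply/orP; right.
  rewrite -[4%N]/(2 ^ 2)%N -expnM mul2n -addnn -[2%N]/(1 + 1)%N expnDn.
  have lt : (r < (r + r).+1)%N by lia.
  by rewrite (bigD1 (Ordinal lt)) //= !exp1n !muln1 leq_addr.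
apply: leq_trans (leq_mul (leqnn _) rr) _.
by rewrite mulnCA bin_ffact mulnC expnMn mulnC leq_mul ?ffact_le_expn.
Qed.

Lemma card_injective_tuples n k : (2 * k <= n)%N ->
  (n ^ k <= 2 ^ k * #|{: {s : k.-tuple 'I_n | uniq s}}|)%N.
Proof.
move=> n_ge.
rewrite card_sub (_ : #|_| = n ^_ k); last first.
  transitivity (#|'I_n| ^_ k); last by rewrite card_ord.
  rewrite -(card_uniq_tuples k xpredT); apply: eq_card => s.
  by rewrite !inE all_predT.
have prodE c : (c ^ k = \prod_(i < k) c)%N by rewrite prod_nat_const card_ord.
rewrite ffact_prod !prodE -big_split /=.
by apply: leq_prod => i _; have := ltn_ord i; lia.
Qed.

(** * Union bound over nonexpanding sets *)

Section BadSets.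
Variables (R : realType) (n m k : nat) (V N : finType) (p : 'I_n -> option V).
Notation constr := ({s : k.-tuple 'I_n | uniq s} * N)%type.
Notation inst := {ffun 'I_m -> constr}.

Variables (U : nat) (C zeta : R) (t : nat).
Hypothesis C_ge0 : 0 <= C.
Hypothesis fixed_le : (#|[set x | p x == None]| <= U)%N.
Hypothesis fiber_le : forall v, (#|[set x | p x == Some v]| <= 2)%N.
Hypothesis U_le : U%:R <= C * Num.sqrt (n%:R : R).
Hypothesis n_gt0 : (0 < n)%N.
Hypothesis n_ge : (2 * k <= n)%N.
Hypothesis N_gt0 : (0 < #|N|)%N.

Definition growth : R := (2 * (C + (2 * k)%:R + 1)) ^+ k.

(** Equivalently, [pot set0 F] is below [zeta * #|F|]. *)
Definition bad (I : inst) (F : {set 'I_m}) :=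
  (weight p I F)%:R < ((2 * k)%:R - t%:R + zeta) * #|F|%:R.

Lemma growth_ge0 : 0 <= growth.
Proof. by rewrite exprn_ge0 // mulr_ge0 // !addr_ge0 ?ler0n. Qed.

(* Exponential moment method with theta = sqrt (r / n), which makes the average of
   theta ^ cost over one slot O(theta ^ 2), whatever was covered before. *)
Lemma card_bad (F : {set 'I_m}) : (0 < #|F| <= n)%N ->
  #|[set I | bad I F]|%:R <=
    (growth * (#|F|%:R / n%:R) `^ ((t%:R - zeta) / 2)) ^+ #|F| * #|{: inst}|%:R.
Proof.
move=> /andP[]; set r := #|F| => r_gt0 r_le.
set th := (r%:R / n%:R : R) `^ 2^-1.
have nR : 0 < n%:R :> R by rewrite ltr0n.
have rR : 0 < r%:R :> R by rewrite ltr0n.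
have q_gt0 : 0 < r%:R / n%:R :> R by rewrite divr_gt0.
have th_gt0 : 0 < th by rewrite powR_gt0.
have th2 : th ^+ 2 = r%:R / n%:R.
  by rewrite /th -powR_mulrn ?powR_ge0 // -powRrM mulVf ?pnatr_eq0 // powRr1 // ltW.
pose Z : R := r%:R * (C + (2 * k)%:R + 1).
have Z_ge : U%:R * th + (2 * (k * r))%:R + #|'I_n|%:R * th ^+ 2 <= Z.
  (* Here [U = O(sqrt n)] enters: [sqrt n * sqrt (r / n) = sqrt r <= r]. *)
  have Uth : U%:R * th <= C * r%:R.
    apply: le_trans (ler_wpM2r (ltW th_gt0) U_le) _; rewrite -mulrA ler_wpM2l //.
    rewrite -powR12_sqrt ?ler0n // /th -powRM ?ler0n ?(ltW q_gt0) //.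
    by rewrite mulrCA divff ?gt_eqF // mulr1 ler1_powR ?ler1n // invf_le1 ?ler1n.
  rewrite card_ord th2 mulrCA divff ?gt_eqF // mulr1 /Z !natrM.
  have -> : r%:R * (C + 2 * k%:R + 1) = C * r%:R + 2 * (k%:R * r%:R) + r%:R by ring.
  by rewrite !lerD2r.
pose kap : R := growth * th ^+ (2 * k).
have kap_ge0 : 0 <= kap by rewrite mulr_ge0 ?growth_ge0 // exprn_ge0 // ltW.
have kap_ge : Z ^+ k <= kap * #|{: {s : k.-tuple 'I_n | uniq s}}|%:R.
  rewrite /kap exprM th2 /growth /Z; set g := C + _ + 1; set sc := #|_|.
  have -> : (r%:R * g) ^+ k = (r%:R / n%:R) ^+ k * g ^+ k * (n ^ k)%:R.
    by rewrite natrX -!exprMn; congr (_ ^+ _); field; rewrite gt_eqF.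
  have -> : (2 * g) ^+ k * (r%:R / n%:R) ^+ k * sc%:R =
      (r%:R / n%:R) ^+ k * g ^+ k * (2 ^ k * sc)%N%:R.
    by rewrite natrM natrX !exprMn; ring.
  rewrite ler_wpM2l ?ler_nat ?(card_injective_tuples n_ge) //.
  by rewrite mulr_ge0 ?exprn_ge0 ?(ltW q_gt0) // !addr_ge0 ?ler0n.
have constr_gt0 : (0 < #|{: constr}|)%N.
  rewrite card_prod muln_gt0 N_gt0 andbT; have := card_injective_tuples n_ge.
  by case: #|_| => //; rewrite muln0 leqn0 expn_eq0 -leqn0 leqNgt n_gt0.
have := sum_weight (ltW th_gt0) fixed_le fiber_le Z_ge kap_ge0 kap_ge constr_gt0 (leqnn _).
rewrite -/r => sum_le.
set b : R := ((2 * k)%:R - t%:R + zeta) * r%:R.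
have thb_gt0 : 0 < th `^ b by rewrite powR_gt0.
rewrite -(ler_pM2l thb_gt0); apply: (@le_trans _ _ (\sum_I th ^+ weight p I F)).
  rewrite mulr_natr -sumr_const [leRHS](bigID (fun I => I \in [set I | bad I F])) /=.
  rewrite -[leLHS]addr0 lerD ?sumr_ge0 // => [|I _]; last by rewrite exprn_ge0 // ltW.
  apply: ler_sum => I; rewrite inE => /ltW badI.
  rewrite -powR_mulrn ?(ltW th_gt0) // ger_powR // th_gt0 /=.
  rewrite -(@expr_le1 _ 2) ?(ltW th_gt0) // th2 ler_pdivrMr ?mul1r ?ler_nat //.
apply: le_trans sum_le _; rewrite mulrA ler_wpM2r ?ler0n //.
have -> : (r%:R / n%:R : R) `^ ((t%:R - zeta) / 2) = th `^ (t%:R - zeta).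
  by rewrite /th -powRrM [2^-1 * _]mulrC.
have key : th `^ b * (th `^ (t%:R - zeta)) ^+ r = (th ^+ (2 * k)) ^+ r.
  rewrite -powR_mulrn ?powR_ge0 // -powRrM -powRD ?(gt_eqF th_gt0) ?implybT //.
  rewrite -exprM -powR_mulrn ?(ltW th_gt0) //; congr (_ `^ _).
  by rewrite /b [in RHS]natrM; ring.
by rewrite !exprMn mulrCA key.
Qed.

Variable P : nat.

(** Size [r] contributes at most [(y r / 4) ^ r <= y r * 4 ^ -r <= r * e * 4 ^ -r <= e * 2 ^ -r],
    and the sum over [r] is at most [e]. *)
Lemma card_bad_union (e : R) (y : nat -> R) : (P <= n)%N -> 0 <= e ->
  (forall r, (0 < r <= P)%N -> 0 <= y r <= 1 /\ y r <= r%:R * e) ->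
  (forall r, (0 < r <= P)%N ->
    4 * (m%:R / r%:R) * growth * (r%:R / n%:R) `^ ((t%:R - zeta) / 2) <= y r / 4) ->
  #|[set I | [exists F : {set 'I_m}, (0 < #|F| <= P)%N && bad I F]]|%:R
    <= e * #|{: inst}|%:R.
Proof.
move=> Pn e_ge0 y_bd y_ge; set tot := #|{: inst}|%:R.
pose g r : R := (growth * (r%:R / n%:R) `^ ((t%:R - zeta) / 2)) ^+ r.
have term r : (0 < r <= P)%N -> 'C(m, r)%:R * g r <= e * 2^-1 ^+ r.
  move=> rP; have [/andP[y_ge0 y_le1] y_le] := y_bd r rP; have r_gt0 : (0 < r)%N by lia.
  have rR : 0 < r%:R :> R by rewrite ltr0n.
  have g_ge0 : 0 <= g r by rewrite exprn_ge0 // mulr_ge0 ?growth_ge0 ?powR_ge0.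
  have binle : 'C(m, r)%:R <= (4 * (m%:R / r%:R)) ^+ r :> R.
    rewrite mulrA expr_div_n ler_pdivlMr ?exprn_gt0 //.
    have -> : (4 * m%:R) ^+ r = ((4 * m) ^ r)%N%:R :> R by rewrite natrX natrM.
    by rewrite -natrX -natrM ler_nat binomial_le_expn.
  apply: le_trans (ler_wpM2r g_ge0 binle) _.
  rewrite -exprMn [_ * (growth * _)]mulrA; apply: (@le_trans _ _ ((y r / 4) ^+ r)).
    rewrite lerXn2r ?nnegrE ?y_ge // ?divr_ge0 //.
    by rewrite !mulr_ge0 ?growth_ge0 ?powR_ge0 ?invr_ge0 ?ler0n.
    rewrite exprMn; apply: (@le_trans _ _ (y r * 4^-1 ^+ r)).
    rewrite ler_wpM2r ?exprn_ge0 ?invr_ge0 ?ler0n //.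
    by rewrite -[leRHS]expr1; apply: ler_wiXn2l; rewrite ?y_ge0.
  apply: (le_trans (ler_wpM2r _ y_le)); first by rewrite exprn_ge0 ?invr_ge0 ?ler0n.
  rewrite mulrAC mulrC ler_wpM2l //.
  have -> : 4^-1 = 2^-1 * 2^-1 :> R by field.
  rewrite exprMn mulrCA mulrA -[leRHS]mul1r ler_wpM2r ?exprn_ge0 ?invr_ge0 ?ler0n //.
  rewrite exprVn mulrC ler_pdivrMr ?exprn_gt0 ?ltr0n // mul1r -natrX ler_nat.
  exact/ltnW/ltn_expl.
have geom : \sum_(r < m.+1 | (0 < r <= P)%N) 2^-1 ^+ r <= 1 :> R.
  apply: (@le_trans _ _ (\sum_(r < m.+1 | (0 < r)%N) 2^-1 ^+ r)).
    rewrite big_mkcond [leRHS]big_mkcond; apply: ler_sum => r _.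
    by case: ltnP => //= _; case: ifP => // _; rewrite exprn_ge0 // invr_ge0.
  have half_sum i : \sum_(r < i.+1 | (0 < r)%N) 2^-1 ^+ r = 1 - 2^-1 ^+ i :> R.
    elim: i => [|i IHi]; first by rewrite big_mkcond big_ord_recr big_ord0 expr0 subrr /= add0r.
    by rewrite big_mkcond big_ord_recr /= -big_mkcond IHi exprS; field.
  by rewrite half_sum lerBlDr lerDl exprn_ge0 ?invr_ge0.
have g_ge0 r : 0 <= g r by rewrite exprn_ge0 // mulr_ge0 ?growth_ge0 ?powR_ge0.
apply: (@le_trans _ _ (\sum_(F : {set 'I_m} | (0 < #|F| <= P)%N) g #|F| * tot)).
  apply: (@le_trans _ _ (\sum_(F : {set 'I_m} | (0 < #|F| <= P)%N)
                          #|[set I | bad I F]|%:R)); last first.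
    by apply: ler_sum => F /andP[F0 FP]; apply: card_bad; lia.
  rewrite -natr_sum ler_nat.
  pose G : {set inst} := \bigcup_(F : {set 'I_m} | (0 < #|F| <= P)%N) [set I | bad I F].
  apply: (@leq_trans #|G|).
    apply/subset_leq_card/subsetP => I; rewrite inE => /existsP[F /andP[FP badF]].
    by apply/bigcupP; exists F => //; rewrite inE.
  rewrite /G; elim/big_ind2: _ => [|x1 A1 x2 A2 le1 le2|//]; first by rewrite cards0.
  by apply: leq_trans (leq_card_setU _ _) _; rewrite leq_add.
rewrite -mulr_suml ler_wpM2r ?ler0n //.
rewrite (partition_big (fun F : {set 'I_m} => inord #|F| : 'I_m.+1)
  (fun r => (0 < r <= P)%N)) => [|F FP]; last first.
  by rewrite inordK // ltnS -[leqRHS]card_ord max_card.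
apply: (@le_trans _ _ (\sum_(r < m.+1 | (0 < r <= P)%N) 'C(m, r)%:R * g r)).
  apply: ler_sum => r rP; apply: (@le_trans _ _ (\sum_(F : {set 'I_m} | #|F| == r) g r)).
    rewrite big_mkcond [leRHS]big_mkcond; apply: ler_sum => F _.
    case: ifPn => [/andP[_ /eqP<-]|_]; last by case: ifP.
    by rewrite inordK ?eqxx // ltnS -[leqRHS]card_ord max_card.
  suff <- : #|[set F : {set 'I_m} | #|F| == r]| = 'C(m, r).
    by rewrite mulr_natl -sumr_const le_eqVlt; apply/orP; left; apply/eqP;
      apply: eq_bigl => F; rewrite inE.
  by rewrite card_draws card_ord.
apply: (@le_trans _ _ (\sum_(r < m.+1 | (0 < r <= P)%N) e * 2^-1 ^+ r)).
  by apply: ler_sum => r; exact: term.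
by rewrite -mulr_sumr -[leRHS]mulr1 ler_wpM2l.
Qed.

End BadSets.

(** * Choice of the parameters *)

Section Calibration.
Variables (R : realType) (k t : nat) (C Delta0 : R).
Hypothesis t_ge3 : (3 <= t)%N.
Hypothesis C_ge0 : 0 <= C.
Hypothesis Delta0_gt1 : 1 < Delta0.

Let K := growth k C.
Let a : R := t%:R - 2.
Let z0 := Num.min 1 (ln Delta0 / 2).
Let mu := (16 * K * expR 1)^-1.
Let kap := mu ^+ 4.

Definition slope : R := z0 * kap / (8 * (2 + k%:R)).

Let a_ge1 : 1 <= a.
Proof. have : 3%:R <= t%:R :> R by rewrite ler_nat. by rewrite /a; lra. Qed.

Let K_ge1 : 1 <= K.
Proof.
rewrite exprn_ege1 //; have : 0 <= (2 * k)%:R :> R by rewrite ler0n.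
by move: (_%:R) C_ge0 => g; lra.
Qed.

Let E_ge1 : 1 <= expR 1 :> R.
Proof. by have := @expR_ge1Dx R 1; lra. Qed.

Let z0_gt0 : 0 < z0.
Proof. by rewrite lt_min ltr01 divr_gt0 // ln_gt0. Qed.

Let mu_gt0 : 0 < mu.
Proof. by rewrite invr_gt0 !mulr_gt0 ?expR_gt0 ?(lt_le_trans _ K_ge1). Qed.

Let kap_gt0 : 0 < kap. Proof. exact: exprn_gt0. Qed.

Let kap_le1 : kap <= 1.
Proof.
rewrite exprn_ile1 ?(ltW mu_gt0) //.
rewrite invf_le1 ?mulr_gt0 ?expR_gt0 ?(lt_le_trans _ K_ge1) //.
have := K_ge1; have := E_ge1; nra.
Qed.

Lemma slope_gt0 : 0 < slope.
Proof.
by rewrite divr_gt0 ?mulr_gt0 // (lt_le_trans (ltr0n _ 2)) // lerDl ler0n.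
Qed.

Definition admissible (n m D P Q : nat) (zeta e : R) (y : nat -> R) :=
  [/\ [/\ 0 < zeta, (2 * (D + k))%:R < zeta * Q.+1%:R, (2 * Q <= P)%N & (Q < P)%N],
      (P <= n)%N, 0 <= e,
      forall r, (0 < r <= P)%N -> 0 <= y r <= 1 /\ y r <= r%:R * e &
      forall r, (0 < r <= P)%N ->
        4 * (m%:R / r%:R) * growth k C * (r%:R / n%:R) `^ ((t%:R - zeta) / 2) <= y r / 4].

Lemma calibration (eps : R) : 0 < eps -> exists N : nat, forall n m : nat, (N <= n)%N ->
  let Delta := m%:R / n%:R in
  let x := slope * (n%:R / (Delta `^ (2 / (t%:R - 2)) * ln Delta)) in
  Delta0 <= Delta -> 1 < x ->
  exists D P Q zeta e y, [/\ x <= D%:R, e <= eps & admissible n m D P Q zeta e y].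
Proof.
move=> eps_gt0; set B := Num.max 2 (eps ^- 4).
exists (Num.truncn (B * expR (2 * B) / kap)).+1 => n m Nn Delta x De_ge x_gt1.
have De_gt1 : 1 < Delta := lt_le_trans Delta0_gt1 De_ge.
have De_gt0 : 0 < Delta by lra.
set L := ln Delta in x x_gt1 *; set A := Delta `^ _ in x x_gt1 *.
have L_ge : ln Delta0 <= L by rewrite ler_ln ?posrE ?(lt_trans ltr01 Delta0_gt1).
have L0_gt0 : 0 < ln Delta0 by rewrite ln_gt0.
have L_gt0 : 0 < L by lra.
have A_gt0 : 0 < A by rewrite powR_gt0.
have n_gt0 : 0 < n%:R :> R by rewrite ltr0n (leq_trans _ Nn).
set X := n%:R / (A * L) in x x_gt1 *.
have X_gt0 : 0 < X by rewrite divr_gt0 // mulr_gt0.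
pose La := kap * n%:R / A.
have LaE : La = kap * X * L by rewrite /La /X; field; rewrite !gt_eqF.
have La_gt0 : 0 < La by rewrite divr_gt0 // mulr_gt0.
have B_ge2 : 2 <= B by rewrite le_max lexx.
have z0_le1 : z0 <= 1 by rewrite ge_min lexx.
have La_geB : B <= La.
  (* For large [Delta] the assumption [1 < x] makes [La] at least [ln Delta]; for bounded [Delta]
     the choice of [N] suffices. *)
  have [BL|LB] := leP B L.
    apply: le_trans BL _; rewrite LaE ler_peMl ?(ltW L_gt0) //.
    have k0 : 0 <= k%:R :> R by rewrite ler0n.
    have : z0 * (kap * X) = x * (8 * (2 + k%:R)).
      by rewrite /x /slope; field; rewrite gt_eqF //; lra.
    have := z0_gt0; have : 0 < kap * X by rewrite mulr_gt0.
    nra.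
  rewrite ler_pdivlMr // mulrC.
  apply: (@le_trans _ _ (expR (2 * B) * B)).
    rewrite ler_wpM2r //; first lra.
    rewrite /A -[Delta](@lnK _) ?posrE // -expRM ler_expR -/L.
    apply: (@le_trans _ _ (L * 2)); last lra.
    rewrite ler_wpM2l ?(ltW L_gt0) // ler_pdivrMr; last by have := a_ge1; rewrite /a; lra.
    by have := a_ge1; rewrite /a; lra.
  rewrite [expR _ * B]mulrC -ler_pdivrMl // [kap^-1 * _]mulrC; apply: ltW.
  apply: lt_le_trans (truncnS_gt _) _.
  by rewrite ler_nat.
have A_ge1 : 1 <= A.
  rewrite -[leLHS](@powRr0 _ Delta) ler_powR ?(ltW De_gt1) // divr_ge0 //.
  by have := a_ge1; rewrite /a; lra.
have La_le : La <= n%:R.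
  rewrite ler_pdivrMr // (le_trans (ler_piMl _ kap_le1)) ?ler0n //.
  by rewrite ler_peMr ?ler0n.
have LaD : La = kap * n%:R / A by [].
clearbody La; pose zeta := z0 / L.
have zeta_gt0 : 0 < zeta by rewrite divr_gt0.
have zeta_le : zeta <= 2^-1.
  by rewrite ler_pdivrMr // ge_min; apply/orP; right; lra.
(* The failure bound is the fourth root of [1 / La], at most [eps] because [B] is at least
   [eps ^- 4]. *)
exists (Num.truncn x).+1, (Num.truncn La), (Num.truncn (La / 4)), zeta.
exists (La^-1 `^ 4^-1), (fun r => (r%:R / La) `^ 4^-1).
have x_ge0 : 0 <= x by lra.
have La4_ge0 : 0 <= La / 4 by lra.
have /andP[x_itv1 x_itv2] := truncn_itv x_ge0.
have /andP[La4_itv1 La4_itv2] := truncn_itv La4_ge0.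
have La_itv := truncn_itv (ltW La_gt0).
split; first exact: ltW.
  rewrite (_ : eps = (eps ^+ 4) `^ 4^-1); last first.
    by rewrite -powR_mulrn ?(ltW eps_gt0) // -powRrM mulfV ?pnatr_eq0 // powRr1 ?ltW.
  rewrite ge0_ler_powR ?nnegrE ?invr_ge0 ?(ltW La_gt0) ?exprn_ge0 ?(ltW eps_gt0) //.
  rewrite invf_ple ?posrE ?exprn_gt0 //; apply: le_trans La_geB.
  by rewrite le_max lexx orbT.
split.
- split=> //.
  + apply: (@le_lt_trans _ _ (zeta * (La / 4))); last by rewrite ltr_pM2l.
    (* The constant in [slope] is chosen for this identity; since [x > 1], the right side exceeds
       [2 * (D + k)]. *)
    have -> : zeta * (La / 4) = 2 * ((2 + k%:R) * x).
      rewrite LaE /zeta /x /slope; field; rewrite !gt_eqF //.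
      by rewrite (lt_le_trans (ltr0n _ 2)) // lerDl ler0n.
    have k0 : 0 <= k%:R :> R by rewrite ler0n.
    rewrite natrM natrD ler_pM2l //.
    apply: (@le_trans _ _ (x + 1 + k%:R)); first by rewrite lerD2r -natr1 lerD2r.
    by have := ler_peMr k0 (ltW x_gt1); lra.
  + by rewrite truncn_ge_nat ?(ltW La_gt0) // natrM; lra.
  + by rewrite truncn_ge_nat ?(ltW La_gt0) // -natr1; lra.
- by rewrite -(ler_nat R); have /andP[/le_trans->] := La_itv.
- exact: powR_ge0.
- move=> r /andP[r_gt0 rP]; have rR : 0 < r%:R :> R by rewrite ltr0n.
  have rLa : r%:R <= La by have /andP[+ _] := La_itv; apply: le_trans; rewrite ler_nat.
  split.
    rewrite powR_ge0 /=; apply: (@le_trans _ _ (1 `^ 4^-1)); last by rewrite powR1.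
    rewrite ge0_ler_powR ?nnegrE ?invr_ge0 ?divr_ge0 ?(ltW rR) ?(ltW La_gt0) //.
    by rewrite ler_pdivrMr ?mul1r.
  rewrite powRM ?invr_ge0 ?(ltW La_gt0) ?(ltW rR) // ler_wpM2r ?powR_ge0 //.
  by rewrite ler1_powR ?ler1n // invf_le1 ?ler1n.
move=> r /andP[r_gt0 rP]; have rR : 0 < r%:R :> R by rewrite ltr0n.
have rLa : r%:R <= La by have /andP[+ _] := La_itv; apply: le_trans; rewrite ler_nat.
set s := (a - zeta) / 2.
have s_ge : 4^-1 <= s by have := a_ge1; rewrite /s; lra.
have rLa_gt0 : 0 < r%:R / La by rewrite divr_gt0.
have rn_gt0 : 0 < r%:R / n%:R :> R by rewrite divr_gt0.
(* One power of [r / n] turns [m / r] into [Delta]; the remaining power [s] has to beat [Delta]. *)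
have -> : (t%:R - zeta) / 2 = 1 + s by rewrite /s /a; field.
rewrite powRD ?(gt_eqF rn_gt0) ?implybT // powRr1 ?(ltW rn_gt0) //.
have -> : r%:R / n%:R = (r%:R / La) * (kap * A^-1) :> R.
  by rewrite LaD; field; rewrite !gt_eqF.
have iA_ge0 : 0 <= A^-1 by rewrite invr_ge0 ltW.
rewrite (powRM s (ltW rLa_gt0) (mulr_ge0 (ltW kap_gt0) iA_ge0)).
rewrite (powRM s (ltW kap_gt0) iA_ge0).
have y_le : (r%:R / La) `^ s <= (r%:R / La) `^ 4^-1.
  by rewrite ger_powR // rLa_gt0 ler_pdivrMr ?mul1r.
have kap_le : kap `^ s <= mu.
  have -> : mu = kap `^ 4^-1.
    by rewrite /kap -powR_mulrn ?(ltW mu_gt0) // -powRrM mulfV ?pnatr_eq0 // powRr1 ?ltW.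
  by rewrite ger_powR // kap_gt0.
have De_A : Delta * A^-1 `^ s <= expR 1.
  have -> : A^-1 `^ s = Delta `^ (- (2 / a * s)).
    by rewrite -powR_inv1 ?(ltW A_gt0) // /A -/a -!powRrM; congr (_ `^ _); ring.
  rewrite -[X in X * _](@powRr1 _ Delta) ?(ltW De_gt0) // -powRD ?(gt_eqF De_gt0) ?implybT //.
  have -> : 1 + - (2 / a * s) = zeta / a.
    by rewrite /s; field; rewrite gt_eqF //; have := a_ge1; lra.
  rewrite -[Delta](@lnK _) ?posrE // -expRM ler_expR -/L.
  have -> : L * (zeta / a) = z0 / a by rewrite /zeta; field; rewrite !gt_eqF //; have := a_ge1; lra.
  by have := a_ge1 => a1; rewrite ler_pdivrMr ?mul1r; lra.
have -> : 4 * (m%:R / r%:R) * growth k C *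
    (r%:R / La * (kap / A) * ((r%:R / La) `^ s * (kap `^ s * A^-1 `^ s))) =
    4 * K * ((r%:R / La) `^ s * (kap `^ s * (Delta * A^-1 `^ s))).
  rewrite -/K /Delta LaD; field.
  by rewrite !gt_eqF.
have -> : (r%:R / La) `^ 4^-1 / 4 = 4 * K * ((r%:R / La) `^ 4^-1 * (mu * expR 1)).
  rewrite /mu; field; rewrite !gt_eqF ?expR_gt0 //.
  by rewrite (lt_le_trans _ K_ge1).
rewrite ler_wpM2l ?mulr_ge0 ?(le_trans _ K_ge1) //.
have De_A_ge0 : 0 <= Delta * A^-1 `^ s by rewrite mulr_ge0 ?powR_ge0 ?(ltW De_gt0).
have le1 := ler_pM (powR_ge0 _ _) De_A_ge0 kap_le De_A.
by apply: ler_pM => //; rewrite ?powR_ge0 // mulr_ge0 ?powR_ge0.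
Qed.

End Calibration.

(** * Fourier analysis of the distributions *)

Section TupleFourier.
Variables (R : realType) (k : nat).
Implicit Types (x : k.-tuple bool) (y A : {set 'I_k}).

Definition tuple_of_set y : k.-tuple bool := [tuple i \in y | i < k].

Definition set_of_tuple x : {set 'I_k} := [set i | tnth x i].

Lemma tuple_of_setK : cancel tuple_of_set set_of_tuple.
Proof. by move=> y; apply/setP => i; rewrite inE tnth_mktuple. Qed.

Lemma set_of_tupleK : cancel set_of_tuple tuple_of_set.
Proof. by move=> x; apply: eq_from_tnth => i; rewrite tnth_mktuple inE. Qed.

Definition parity A x : R := \prod_(i in A) (-1) ^+ tnth x i.

Lemma parityE A y : parity A (tuple_of_set y) = chi R A y.
Proof.
rewrite /parity big_mkcond; apply: eq_bigr => i _; rewrite tnth_mktuple.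
by case: (i \in A).
Qed.

Definition fhat (F : k.-tuple bool -> R) A := hat (fun y => F (tuple_of_set y)) A.

Lemma tuple_fourier F x : F x = \sum_A fhat F A * parity A x.
Proof.
rewrite -{1}[x]set_of_tupleK (fourier_inversion (fun y => F (tuple_of_set y))).
by apply: eq_bigr => A _; rewrite -parityE set_of_tupleK.
Qed.

Lemma sum_tuples (F : k.-tuple bool -> R) : \sum_x F x = \sum_y F (tuple_of_set y).
Proof. by rewrite (reindex _ (onW_bij _ (Bijective tuple_of_setK set_of_tupleK))). Qed.

Lemma fhatE F A : #|{: {set 'I_k}}|%:R * fhat F A = \sum_x F x * parity A x.
Proof.
rewrite /fhat /hat /avg mulrA divff ?card_setV_neq0 // mul1r sum_tuples.
by apply: eq_bigr => y _; rewrite parityE.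
Qed.

Lemma wise_uniform_negate s z (mu : dist R k) :
  wise_uniform s mu -> wise_uniform s (negate z mu).
Proof.
move=> mu_unif S a Ss; rewrite -(mu_unif S (xor_tuple z a) Ss).
rewrite [RHS](reindex_inj (inv_inj (xor_tupleK z))) /=; apply: eq_bigl => x.
by apply: eq_forallb_in => i _; rewrite !tnth_mktuple (inj_eq (can_inj (addKb _))).
Qed.

Lemma set_extend A s : (#|A| <= s <= k)%N -> exists2 S : {set 'I_k}, A \subset S & #|S| = s.
Proof.
move=> /andP[/subnKC<-]; elim: (s - #|A|)%N => [|d IHd] le_k.
  by exists A; rewrite ?addn0.
have [|S AS Sd] := IHd; first by lia.
have : (0 < #|~: S|)%N by have := cardsC S; rewrite card_ord; lia.
case/card_gt0P=> i; rewrite inE => iS; exists (i |: S).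
  by rewrite (subset_trans AS) ?subsetUr.
by rewrite cardsU1 iS Sd; lia.
Qed.

Lemma sum_parity A : A != set0 -> \sum_x parity A x = 0.
Proof.
move=> A0; rewrite sum_tuples; under eq_bigr => y _ do rewrite parityE.
have /eqP := avg_chi R A; rewrite (negPf A0) mulf_eq0 invr_eq0.
by rewrite (negPf (card_setV_neq0 _ R)) => /eqP.
Qed.

(* Averaging the character over the completions of a restriction to S: the
   marginal on S is constant, so only the plain sum of the character is left. *)
Lemma wise_uniform_parity s (mu : dist R k) A : (s <= k)%N ->
  wise_uniform s mu -> (0 < #|A| <= s)%N -> \sum_x mu x * parity A x = 0.
Proof.
move=> sk mu_unif /andP[A_gt0 As].
have A_neq0 : A != set0 by rewrite -card_gt0.
(* [wise_uniform] speaks only of sets of exactly [s] coordinates, so [A] is enlarged. *)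
have [|S AS Ss] := @set_extend A s; first by rewrite As.
pose agree (a x : k.-tuple bool) := [forall i in S, tnth x i == tnth a i].
have agree_parity a x : agree a x -> parity A a = parity A x.
  move=> /forall_inP ax; apply: eq_bigr => i iA.
  by rewrite (eqP (ax i _)) // (subsetP AS).
pose N := #|[set a : k.-tuple bool | agree a (nseq_tuple k false)]|.
have cardN x : \sum_(a | agree a x) (1 : R) = N%:R.
  rewrite sumr_const /N; congr (_%:R).
  rewrite -(card_imset _ (inv_inj (xor_tupleK x))).
  apply: eq_card => a; rewrite [in RHS]inE; apply/imsetP/forall_inP => /=.
    case=> a' /forall_inP ax -> i iS.
    by rewrite tnth_mktuple tnth_nseq (eqP (ax i iS)) addbb.
  move=> a0; exists (xor_tuple x a); last by rewrite xor_tupleK.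
  apply/forall_inP => i iS; have /eqP := a0 i iS.
  by rewrite tnth_nseq tnth_mktuple => <-; rewrite addbF.
have N_neq0 : N%:R != 0 :> R.
  rewrite pnatr_eq0 -lt0n; apply/card_gt0P; exists (nseq_tuple k false).
  by rewrite inE; apply/forall_inP.
apply: (mulfI N_neq0); rewrite mulr0.
transitivity (\sum_x \sum_(a | agree a x) mu x * parity A a).
  rewrite mulr_sumr; apply: eq_bigr => x _; rewrite -(cardN x) mulr_suml.
  by apply: eq_bigr => a /agree_parity->; rewrite mul1r.
rewrite (exchange_big_dep xpredT) //=.
transitivity (\sum_a (2 ^+ s)^-1 * parity A a); last by rewrite -mulr_sumr sum_parity ?mulr0.
by apply: eq_bigr => a _; rewrite -mulr_suml (mu_unif S a Ss).
Qed.

End TupleFourier.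

(** * From moments to polynomials *)

Section Evaluation.
Variables (R : realType) (n : nat).

Definition bpt (x : 'I_n -> bool) (i : 'I_n) : R := (x i)%:R.

Definition read k (s : k.-tuple 'I_n) (x : 'I_n -> bool) : k.-tuple bool :=
  [tuple x (tnth s i) | i < k].

Lemma meval_indicator k (s : k.-tuple 'I_n) a x :
  (indicator R s a).@[bpt x] = (read s x == a)%:R.
Proof.
rewrite /indicator rmorph_prod /=.
transitivity (\prod_(i < k) (x (tnth s i) == tnth a i)%:R : R).
  apply: eq_bigr => i _; case: (tnth a i); rewrite ?mevalB ?meval1 mevalXU /bpt.
    by rewrite eqb_id.
  by case: (x _); rewrite ?subrr ?subr0.
have [<-|/eqP ne] := eqVneq (read s x) a.
  by rewrite big1 // => i _; rewrite tnth_mktuple eqxx.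
suff [i xi] : exists i, x (tnth s i) != tnth a i.
  by rewrite (bigD1 i) //= (negPf xi) mul0r.
apply/existsP; rewrite -negb_forall; apply/forallP => eq_x; apply: ne.
by apply: eq_from_tnth => i; rewrite tnth_mktuple; apply/eqP.
Qed.

Lemma meval_support_poly (c : dconstr R n) x :
  (support_poly c).@[bpt x] = (distr c (read (val (scope c)) x) != 0)%:R.
Proof.
rewrite /support_poly raddf_sum /=; under eq_bigr => a _ do rewrite meval_indicator.
set r := read _ _; have [r0|r0] := eqVneq (distr c r) 0.
  rewrite big1 // => a a0; case: eqVneq => // ra.
  by rewrite -ra r0 eqxx in a0.
rewrite (bigD1 r) //= eqxx big1 ?addr0 // => a /andP[_ ar].
by rewrite eq_sym (negPf ar).
Qed.

(** Each coordinate is replaced by a function of degree at most 1, and degrees add under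
    products. *)
Lemma meval_hat_deg (V : finType) d (q : {mpoly R[n]}) (x : {set V} -> 'I_n -> bool) :
  (forall i, hat_deg 1 (fun y => bpt (x y) i)) -> deg_le d q ->
  hat_deg d (fun y => q.@[bpt (x y)]).
Proof.
move=> x1 qd A dA; rewrite (eq_hat _ (fun y => mevalE _ _)).
apply: hat_deg_sum dA => m /msize_mdeg_lt md; apply: hat_degZ.
apply: (@hat_degW _ _ (mdeg m)); first by rewrite -ltnS (leq_trans md).
rewrite mdegE; apply: hat_deg_prod => i; rewrite -[X in hat_deg X _]muln1.
exact: hat_degX.
Qed.

End Evaluation.

(** * Substitution eliminating the imposed constraints *)

Section Literals.
Variables (R : realType) (n U : nat) (b : U.-tuple bool).

(* Both elements of a pair are expressed through the first one. *)
Definition pair_rep (i : 'I_n) : 'I_n :=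
  Ordinal (leq_ltn_trans (leq_subr (odd (i - U)) i) (ltn_ord i)).

Definition literal (i : 'I_n) : option 'I_n :=
  if (i < U)%N then None else Some (pair_rep i).

(** The parity of [i - U] negates the second member of a pair, so every such assignment meets all
    imposed constraints. *)
Definition assign (y : {set 'I_n}) (i : 'I_n) : bool :=
  if (i < U)%N then nth false b i else (pair_rep i \in y) (+) odd (i - U).

Definition lit_sign (i : 'I_n) : R :=
  (-1) ^+ (if (i < U)%N then nth false b i else odd (i - U)).

Lemma sign_assign y i :
  (-1) ^+ assign y i = lit_sign i * \prod_v (-1) ^+ ((literal i == Some v) && (v \in y)) :> R.
Proof.
rewrite /assign /lit_sign /literal; case: ifP => _.
  by rewrite big1 ?mulr1.
rewrite signr_addb mulrC; congr (_ * _); rewrite (bigD1 (pair_rep i)) //= eqxx.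
rewrite big1 ?mulr1 // => v /negPf vi.
by rewrite (_ : (Some _ == Some v) = false) //; apply/eqP => -[/eqP]; rewrite eq_sym vi.
Qed.

Lemma card_literal_None : (#|[set i | literal i == None]| <= U)%N.
Proof.
rewrite -[leqRHS]card_ord; case: (posnP U) => [U0|U_gt0].
  rewrite (_ : [set i | _] = set0) ?cards0 //.
  by apply/setP => i; rewrite !inE /literal ifF // U0.
pose f (i : 'I_n) : 'I_U := insubd (Ordinal U_gt0) (i : nat).
rewrite -(@card_in_imset _ _ f) ?max_card // => i j.
rewrite !inE /literal; case: ifP => // iU _; case: ifP => // jU _ /(congr1 val).
by rewrite !val_insubd iU jU => ij; apply: val_inj.
Qed.

Lemma card_literal_Some v : (#|[set i | literal i == Some v]| <= 2)%N.
Proof.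
rewrite -card_bool -(@card_in_imset _ _ (fun i : 'I_n => odd (i - U))) ?max_card //.
move=> i j; rewrite !inE /literal; case: ltnP => // Ui /eqP[/(congr1 val) /= iv].
case: ltnP => // Uj /eqP[/(congr1 val) /= jv] ij; apply: val_inj => /=.
by move: iv jv; rewrite -ij; case: (boolP (odd (i - U))); lia.
Qed.

Lemma assign_hat_deg i : hat_deg 1 (fun y => bpt R (assign y) i).
Proof.
have e y : bpt R (assign y) i = 2^-1 + - (2^-1 * lit_sign i) *
    chi R [set v | literal i == Some v] y.
  have -> : bpt R (assign y) i = 2^-1 + - 2^-1 * (-1) ^+ assign y i.
    by rewrite /bpt; case: assign => /=; field.
  rewrite sign_assign mulNr mulNr mulrA; congr (_ - _ * _).
  by apply: eq_bigr => v _; rewrite inE.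
move=> A A1; rewrite (eq_hat _ e) hatD hatZ (@hat_deg_cst _ _ _) ?(ltnW A1) //.
rewrite (@hat_deg_chi _ R [set v | literal i == Some v]) ?mulr0 ?addr0 //.
apply: leq_ltn_trans A1; rewrite /literal; case: ifP => _.
  by rewrite (_ : [set _ | _] = set0) ?cards0 //; apply/setP => v; rewrite !inE.
rewrite (_ : [set _ | _] = [set pair_rep i]) ?cards1 //.
by apply/setP => v; rewrite !inE eq_sym; apply/eqP/eqP => [[]|->].
Qed.

Variables (k : nat) (s : k.-tuple 'I_n).

(** The signs due to fixed bits and negated members of pairs do not depend on [y], so they are moved
    into the Fourier coefficients. *)
Definition scope_sign (A : {set 'I_k}) : R := \prod_(i in A) lit_sign (tnth s i).

Lemma parity_read (J : finType) (slot : J -> 'I_k -> option 'I_n) j A y :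
  (forall i, slot j i = literal (tnth s i)) ->
  parity R A (read s (assign y)) = scope_sign A * chi R (bd slot j A) y.
Proof.
move=> slotE; rewrite /parity; under eq_bigr => i _ do rewrite tnth_mktuple sign_assign.
rewrite big_split exchange_big; congr (_ * _); apply: eq_bigr => v _ /=.
rewrite inE /mult; case: (v \in y); last by rewrite andbF big1 // => i _; rewrite andbF.
rewrite andbT signr_odd -prodrXr; apply: eq_bigr => i _.
by rewrite andbT slotE.
Qed.

Lemma read_fourier (J : finType) (slot : J -> 'I_k -> option 'I_n) j (F : k.-tuple bool -> R) y :
  (forall i, slot j i = literal (tnth s i)) ->
  F (read s (assign y)) =
    \sum_A (fhat F A * scope_sign A) * chi R (bd slot j A) y.
Proof.
move=> slotE; rewrite tuple_fourier; apply: eq_bigr => A _.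
by rewrite (parity_read _ _ slotE) mulrA.
Qed.

End Literals.

Section Imposed.
Variables (R : realType) (n U : nat) (b : U.-tuple bool).

Lemma imposed_support (c : dconstr R n) y : imposed b c ->
  (support_poly c - 1).@[bpt R (assign b y)] = 0.
Proof.
move=> c_imp; rewrite mevalB meval1 meval_support_poly.
suff -> : distr c (read (val (scope c)) (assign b y)) != 0 by rewrite subrr.
case: c_imp => [i iU|i j neq_ij Ui ev jE] /=; rewrite /unif_fun.
  rewrite (_ : read _ _ = [tuple nth false b i]) ?set11 ?invr_eq0 ?cards1 ?oner_eq0 //.
  by apply: eq_from_tnth => l; rewrite tnth_mktuple !ord1 /= /assign iU.
set x := read _ _; suff -> : x \in [set [tuple false; true]; [tuple true; false]].
  rewrite invr_eq0 pnatr_eq0 -lt0n; apply/card_gt0P.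
  by exists [tuple false; true]; rewrite set21.
have xi : assign b y j = ~~ assign b y i.
  have Uj : (U <= j)%N by rewrite jE (leq_trans Ui).
  rewrite /assign !ltnNge Ui Uj /=.
  have -> : pair_rep U j = pair_rep U i.
    by apply: val_inj => /=; rewrite jE (subSn Ui) oddS (negPf ev) subn0 subn1.
  by rewrite jE (subSn Ui) oddS (negPf ev) addbT addbF.
have -> : x = [tuple assign b y i; ~~ assign b y i].
  apply: eq_from_tnth => -[[|[|l]] lt2] //; rewrite tnth_mktuple.
    by rewrite !(tnth_nth i) !(tnth_nth false) /=.
  by rewrite !(tnth_nth i) !(tnth_nth false) /= xi.
case: (assign b y i); [rewrite in_set2 orbC|rewrite in_set2]; apply/orP; left.
  by apply/eqP/val_inj.
by apply/eqP/val_inj.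
Qed.

End Imposed.

(** * The pseudoexpectation defined by given moments *)

Section Functional.
Variables (R : realType) (n U : nat) (b : U.-tuple bool) (M : {set 'I_n} -> R).

Definition lfun (f : {set 'I_n} -> R) := \sum_S M S * hat f S.

(** It sees a polynomial only through its values on the substituted points, so Boolean reduction and
    the imposed constraints hold without any degree bound. *)
Definition pexp (p : {mpoly R[n]}) := lfun (fun y => p.@[bpt R (assign b y)]).

Lemma eq_lfun f g : f =1 g -> lfun f = lfun g.
Proof. by move=> fg; apply: eq_bigr => S _; rewrite (eq_hat S fg). Qed.

Lemma lfunD f g : lfun (fun y => f y + g y) = lfun f + lfun g.
Proof. by rewrite -big_split; apply: eq_bigr => S _; rewrite hatD mulrDr. Qed.

Lemma lfunZ a f : lfun (fun y => a * f y) = a * lfun f.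
Proof. by rewrite mulr_sumr; apply: eq_bigr => S _; rewrite hatZ mulrCA. Qed.

Lemma lfun_sum (I : finType) (P : pred I) (f : I -> {set 'I_n} -> R) :
  lfun (fun y => \sum_(i | P i) f i y) = \sum_(i | P i) lfun (f i).
Proof.
by rewrite [RHS]exchange_big; apply: eq_bigr => S _; rewrite hat_sum mulr_sumr.
Qed.

Lemma lfun_chi S : lfun (chi R S) = M S.
Proof.
rewrite /lfun (bigD1 S) //= hat_chi eqxx mulr1 big1 ?addr0 // => T /negPf TS.
by rewrite hat_chi eq_sym TS mulr0.
Qed.

Lemma lfun0 f : (forall y, f y = 0) -> lfun f = 0.
Proof.
move=> f0; rewrite (@eq_lfun _ (fun y => 0 * f y)) => [|y]; last by rewrite f0 mul0r.
by rewrite lfunZ mul0r.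
Qed.

Lemma lfun_sqr f :
  lfun (fun y => f y ^+ 2) = \sum_S \sum_T hat f S * hat f T * M (symd S T).
Proof.
rewrite (@eq_lfun _ (fun y => \sum_S \sum_T hat f S * hat f T * chi R (symd S T) y)).
  rewrite lfun_sum; apply: eq_bigr => S _; rewrite lfun_sum.
  by apply: eq_bigr => T _; rewrite lfunZ lfun_chi.
move=> y; rewrite expr2 {1 2}(fourier_inversion f y) mulr_suml.
apply: eq_bigr => S _; rewrite mulr_sumr; apply: eq_bigr => T _.
by rewrite chiM; ring.
Qed.

Lemma pexp_pseudodistribution D : M set0 = 1 ->
  (forall q : {set 'I_n} -> R, (forall S : {set 'I_n}, (D./2 < #|S|)%N -> q S = 0) ->
     0 <= \sum_S \sum_T q S * q T * M (symd S T)) ->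
  pseudodistribution D pexp.
Proof.
move=> M0 M_psd; split.
- move=> a p q _ _; rewrite /pexp -lfunZ -lfunD; apply: eq_lfun => y.
  by rewrite mevalD mevalZ.
- move=> i p _; apply: lfun0 => y; rewrite mevalM mevalB rmorphXn /= mevalXU /bpt.
  by case: assign; rewrite ?expr1n ?expr0n ?subrr ?mul0r.
- rewrite /pexp -[RHS]M0 -lfun_chi; apply: eq_lfun => y.
  by rewrite meval1 chi0.
move=> q qd; rewrite /pexp (@eq_lfun _ (fun y => q.@[bpt R (assign b y)] ^+ 2)).
  rewrite lfun_sqr; apply: M_psd => S Sd.
  by rewrite (meval_hat_deg _ qd) // => i; exact: assign_hat_deg.
by move=> y; rewrite rmorphXn.
Qed.

Lemma weakly_satisfies_zero D (c : dconstr R n) :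
  (forall y, (support_poly c - 1).@[bpt R (assign b y)] = 0) ->
  weakly_satisfies D pexp c.
Proof. by move=> c0 p _; apply: lfun0 => y; rewrite mevalM c0 mul0r. Qed.

Lemma deg_le_factor D (p q : {mpoly R[n]}) : deg_le D (p * q) -> p != 0 -> deg_le D q.
Proof.
rewrite /deg_le; have [->|q0] := eqVneq q 0; first by rewrite msize0.
move=> + p0; rewrite msizeM //; apply: leq_trans.
by rewrite -(@prednK (msize p)) ?lt0n ?msize_poly_eq0 // addSn leq_addl.
Qed.

End Functional.

(** * Pseudodistributions for a fixed instance *)

Section Instances.
Variables (R : realType) (n m k t U : nat) (b : U.-tuple bool) (nu : dist R k).
Variable I : instance n m k.
Hypothesis t_le : (t.-1 <= k)%N.
Hypothesis nu_unif : wise_uniform t.-1 nu.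

Lemma negate_parity z (A : {set 'I_k}) : (0 < #|A| < t)%N ->
  \sum_x negate z nu x * parity R A x = 0.
Proof.
move=> At; have A1 : (0 < #|A| <= t.-1)%N by lia.
exact: (wise_uniform_parity t_le (wise_uniform_negate z nu_unif) A1).
Qed.

(** Moments are built for degree [D + k]: the multiplier may have degree [D], and the constraint
    polynomial involves [k] more slots. *)
Lemma expanding_has_pseudodistribution (D P Q : nat) (zeta : R) :
  0 < zeta ->
  (forall F : {set 'I_m}, (#|F| <= P)%N ->
    zeta * #|F|%:R <= (pot t (inst_slot (literal U) I) set0 F)%:~R) ->
  (2 * (D + k))%:R < zeta * Q.+1%:R -> (2 * Q <= P)%N -> (Q < P)%N ->
  has_weak_pseudodistribution D nu I b.
Proof.
move=> zeta_gt0 expanding Q_large Q2 QP.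
(* This factor turns probabilities into densities relative to the uniform measure, whose empty
   Fourier coefficient is 1. *)
pose N : R := #|{: {set 'I_k}}|%:R.
pose nz j := negate (I j).2 nu; pose s j := val (I j).1.
pose w j y := N * nz j (read (s j) (assign b y)).
pose c j A := N * fhat (nz j) A * scope_sign R b (s j) A.
have slotE j i : inst_slot (literal U) I j i = literal U (tnth (s j) i) by [].
have w_ge0 j y : 0 <= w j y by rewrite mulr_ge0 ?ler0n ?pr_ge0.
have w_expand j y :
    w j y = \sum_A c j A * chi R (bd (inst_slot (literal U) I) j A) y.
  rewrite /w (read_fourier _ _ _ (slotE j)) mulr_sumr.
  apply: eq_bigr => A _; rewrite mulrA; congr (_ * _); rewrite /c; exact: mulrA.
have c0 j : c j set0 = 1.
  rewrite /c fhatE /scope_sign big_set0 mulr1 -[RHS](pr_sum1 (nz j)).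
  by apply: eq_bigr => x _; rewrite /parity big_set0 mulr1.
have c_small j (A : {set 'I_k}) : (0 < #|A| < t)%N -> c j A = 0.
  by move=> At; rewrite /c fhatE negate_parity // mul0r.
have [M [M0 M_psd M_con]] := pseudo_moments w_ge0 w_expand c0 c_small
  zeta_gt0 expanding Q_large Q2 QP.
exists (pexp b M); split.
- apply: pexp_pseudodistribution => // q qD; apply: (M_psd D./2) => //.
  by have := odd_double_half D; rewrite -mul2n; lia.
- move=> j p pD; have [->|supp_neq0] := eqVneq (support_poly (random_constr nu I j) - 1) 0.
    by apply: lfun0 => y; rewrite mul0r meval0.
  have p_deg : hat_deg D (fun y => p.@[bpt R (assign b y)]).
    by apply: meval_hat_deg (deg_le_factor pD supp_neq0) => i; exact: assign_hat_deg.
  pose F x : R := (nz j x != 0)%:R - 1.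
  pose g A := fhat F A * scope_sign R b (s j) A.
  set ph := hat (fun y => p.@[bpt R (assign b y)]) in p_deg.
  have FE y : F (read (s j) (assign b y)) =
      \sum_A g A * chi R (bd (inst_slot (literal U) I) j A) y.
    exact: (read_fourier _ _ _ (slotE j)).
  transitivity (lfun M (fun y => \sum_T ph T * \sum_A g A *
      chi R (symd (bd (inst_slot (literal U) I) j A) T) y)).
    apply: eq_lfun => y; rewrite mevalM mevalB meval1 meval_support_poly -/(F _) FE.
    rewrite (fourier_inversion (fun y => p.@[bpt R (assign b y)]) y) mulr_sumr.
    apply: eq_bigr => T _; rewrite mulrCA; congr (_ * _); rewrite mulr_suml.
    by apply: eq_bigr => A _; rewrite chiM mulrA.
  rewrite lfun_sum big1 // => T _; rewrite lfunZ.
  have [TD|TD] := leqP #|T| D; last by rewrite /ph p_deg ?mul0r.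
  rewrite lfun_sum; under eq_bigr => A _ do rewrite lfunZ lfun_chi.
  rewrite M_con ?mulr0 ?leq_add2r // => y; rewrite -FE /w /F mulf_eq0 negb_or.
  by case/andP=> _ ->; rewrite subrr.
- by move=> c' /imposed_support c'0; exact: weakly_satisfies_zero.
Qed.

(* A nonconstant predicate containing the support has degree at least t, so at
   degree 1 the random constraints impose nothing and any point works. *)
Lemma degree1_has_pseudodistribution : (3 <= t)%N ->
  has_weak_pseudodistribution 1 nu I b.
Proof.
move=> t_ge3; pose x0 : 'I_n -> R := bpt R (assign b set0).
exists (fun p => p.@[x0]); split.
- split=> [a p q _ _|i p _||q _].
  + by rewrite mevalD mevalZ.
  + rewrite mevalM mevalB rmorphXn /= mevalXU /x0 /bpt.
    by case: assign; rewrite ?expr1n ?expr0n ?subrr ?mul0r.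
  + exact: meval1.
  + by rewrite rmorphXn sqr_ge0.
- move=> j p; set S := support_poly _ - 1 => pD.
  have [->|p0] := eqVneq p 0; first by rewrite mulr0 meval0.
  have {p0}S_deg : deg_le 1 S by apply: deg_le_factor p0; rewrite mulrC.
  pose nz := negate (I j).2 nu; pose s := val (I j).1.
  pose G x : R := (nz x != 0)%:R - 1.
  have G_neg x : G x <= 0 by rewrite /G; case: eqP => _; rewrite ?subrr // sub0r oppr_le0.
  (* The polynomial is evaluated on the whole cube, without the substitution, so the distinct scope
     variables are independent coordinates. *)
  pose h (y : {set 'I_n}) := S.@[bpt R (fun i => i \in y)].
  have hE y : h y = G (read s (fun i => i \in y)).
    by rewrite /h mevalB meval1 meval_support_poly.
  have h_deg : hat_deg 1 h.
    apply: meval_hat_deg S_deg => i A A1.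
    rewrite (@eq_hat _ _ _ (fun y => 2^-1 + - 2^-1 * chi R [set i] y)) => [|y].
      rewrite hatD hatZ (hat_deg_cst _ (ltnW A1)).
      by rewrite (@hat_deg_chi _ R [set i]) ?cards1 // mulr0 addr0.
    by rewrite chi1 /bpt; case: (i \in y) => /=; field.
  have s_inj : injective (tnth s) by apply/tuple_uniqP; exact: (valP (I j).1).
  have chi_im (A : {set 'I_k}) y :
      chi R (tnth s @: A) y = parity R A (read s (fun i => i \in y)).
    rewrite /chi /parity (bigID (fun v => v \in tnth s @: A)) /= [X in _ * X]big1 ?mulr1.
      rewrite big_imset /=; last by move=> i i' _ _ /s_inj.
      by apply: eq_bigr => i iA; rewrite tnth_mktuple imset_f.
    by move=> v /negPf->.
  have Ghat (A : {set 'I_k}) : (1 < #|A|)%N -> fhat G A = 0.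
    move=> A1; rewrite -(h_deg (tnth s @: A)) ?card_imset //.
    rewrite (eq_hat _ (fun y => etrans (hE y) (tuple_fourier G _))) hat_sum.
    rewrite (bigD1 A) //= big1 ?addr0 => [|B BA].
      rewrite hatZ (eq_hat _ (fun y => esym (chi_im A y))) hat_chi eqxx mulr1 //.
    rewrite hatZ (eq_hat _ (fun y => esym (chi_im B y))) hat_chi.
    by rewrite (inj_eq (imset_inj s_inj)) (negPf BA) mulr0.
  (* [G] has degree at most 1 and [nz] annihilates single characters, so the mean of [G] under [nz]
     is its uniform mean. *)
  have Gsum : \sum_x nz x * G x = fhat G set0.
    under eq_bigr => x _ do rewrite (tuple_fourier G x) mulr_sumr.
    rewrite exchange_big (bigD1 set0) //= [X in _ + X]big1 ?addr0 => [|A A0].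
      transitivity (fhat G set0 * \sum_x nz x); last by rewrite pr_sum1 mulr1.
      by rewrite mulr_sumr; apply: eq_bigr => x _; rewrite /parity big_set0 mulr1 mulrC.
    have [A1|A1] := ltnP 1 #|A|.
      by apply: big1 => x _; rewrite Ghat // mul0r mulr0.
    transitivity (fhat G A * \sum_x nz x * parity R A x).
      by rewrite mulr_sumr; apply: eq_bigr => x _; rewrite mulrCA.
    by rewrite negate_parity ?mulr0 // card_gt0 A0 (leq_ltn_trans A1) // ltnW.
  (* [G] vanishes on the support of [nz], so its uniform mean is 0; being nonpositive, it is
     identically 0. *)
  have G0 x : G x = 0.
    have nzG0 y : nz y * G y = 0.
      by rewrite /G; case: eqVneq => [->|_]; rewrite ?mul0r // subrr mulr0.
    have : #|{: {set 'I_k}}|%:R * fhat G set0 = 0 by rewrite -Gsum big1 ?mulr0.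
    rewrite fhatE; under eq_bigr => y _ do rewrite /parity big_set0 mulr1.
    move=> /eqP; rewrite -oppr_eq0 -sumrN => /eqP sum0.
    have := psumr_eq0P _ sum0 (i := x) isT => /= Gx0.
    by apply/eqP; rewrite -oppr_eq0 Gx0 // => y _; rewrite oppr_ge0.
  by rewrite mevalM mevalB meval1 meval_support_poly -/(G _) G0 mul0r.
- by move=> c' /imposed_support c'0 p _; rewrite mevalM c'0 mul0r.
Qed.

End Instances.

(** * Assembly of the probabilistic statement *)

Lemma unif_prob_ge (R : realType) (T : finType) (A : T -> Prop) (B : {set T}) (e : R) :
  (0 < #|T|)%N -> #|B|%:R <= e * #|T|%:R -> (forall x, x \notin B -> A x) ->
  1 - e <= unif_prob R A.
Proof.
move=> T_gt0 Be BA; rewrite /unif_prob ler_pdivlMr ?ltr0n // mulrBl mul1r.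
rewrite lerBlDr; apply: (@le_trans _ _ (#|~: B|%:R + #|B|%:R)).
  by rewrite -natrD addnC cardsC.
rewrite lerD // ler_nat; apply/subset_leq_card/subsetP => x.
by rewrite inE => /BA Ax; rewrite inE; apply/asboolP.
Qed.

Theorem theorem6 (R : realType) (k t : nat) (nu : dist R k) (Delta0 C : R)
    (t_ge3 : (3 <= t)%N) (t_le : (t.-1 <= k)%N)
    (nu_unif : wise_uniform t.-1 nu) (Delta0_gt1 : 1 < Delta0) :
  exists2 c : R, 0 < c &
  forall eps : R, 0 < eps ->
  exists N : nat, forall (n m U : nat) (b : U.-tuple bool),
    (N <= n)%N -> (U <= n)%N -> ~~ odd (n - U) ->
    U%:R <= C * Num.sqrt (n%:R : R) ->
    let Delta : R := m%:R / n%:R in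
    Delta0 <= Delta ->
    1 - eps <= unif_prob R (fun I : instance n m k =>
      exists2 D : nat,
        c * (n%:R / (Delta `^ (2 / (t%:R - 2)) * ln Delta)) <= D%:R &
        has_weak_pseudodistribution D nu I b).
Proof.
(* The parameters are calibrated with the absolute value of [C], which keeps the bound on [U]. *)
have C_ge0 : 0 <= `|C| by [].
exists (slope k `|C| Delta0); first exact: slope_gt0.
move=> eps eps_gt0.
have [N NP] := calibration k t_ge3 C_ge0 Delta0_gt1 eps_gt0.
exists (maxn N (2 * k).+1) => n m U b; rewrite geq_max => /andP[Nn kn] _ _ U_le Delta De_ge.
have n_gt0 : (0 < n)%N by lia.
have k2n : (2 * k <= n)%N by lia.
have U_le' : U%:R <= `|C| * Num.sqrt (n%:R : R).
  by apply: le_trans U_le _; rewrite ler_wpM2r ?sqrtr_ge0 // ler_norm.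
have bits_gt0 : (0 < #|{: k.-tuple bool}|)%N by rewrite card_tuple card_bool expn_gt0.
have inst_gt0 : (0 < #|{: instance n m k}|)%N.
  rewrite card_ffun card_prod expn_gt0 muln_gt0 bits_gt0 andbT.
  have := card_injective_tuples k2n.
  by case: #|_| => //; rewrite muln0 leqn0 expn_eq0 -leqn0 leqNgt n_gt0.
(* When the target degree is at most 1, degree 1 works for every instance; otherwise [1 < x] feeds
   the calibration. *)
set x := slope _ _ _ * _; have [x_le1|x_gt1] := leP x 1.
  apply: (@unif_prob_ge _ _ _ set0) => // [|I _].
    by rewrite cards0 mulr_ge0 ?ler0n // ltW.
  by exists 1%N => //; exact: degree1_has_pseudodistribution t_le nu_unif t_ge3.
have [D [P [Q [zeta [e [y [xD e_le [[zeta_gt0 Q_large Q2 QP] Pn e_ge0 y_bd y_ge]]]]]]]] :=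
  NP n m Nn De_ge x_gt1.
have bad_le := card_bad_union C_ge0 (@card_literal_None n U) (@card_literal_Some n U)
  U_le' n_gt0 k2n bits_gt0 Pn e_ge0 y_bd y_ge.
apply: unif_prob_ge inst_gt0 _ _.
  by apply: le_trans bad_le _; rewrite ler_wpM2r ?ler0n.
move=> I; rewrite inE negb_exists => /forallP not_bad; exists D => //.
(* An instance without bad sets is expanding: the two inequalities differ by the deterministic part
   of the potential. *)
apply: (expanding_has_pseudodistribution b t_le nu_unif zeta_gt0 _ Q_large Q2 QP) => F FP.
have [F0|F_gt0] := posnP #|F|.
  by rewrite F0 mulr0 (eqP (_ : F == set0)) -?cards_eq0 ?F0 // pot_set0 cards0.
have := not_bad F; rewrite F_gt0 FP /= /bad -leNgt.
rewrite /pot setU0 /weight intrB.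
set W := (2 * #|_| + _)%N => W_ge.
have -> : (W + t * #|F|)%N%:~R - (2 * k * #|F|)%N%:~R =
    W%:R + t%:R * #|F|%:R - (2 * k)%:R * #|F|%:R :> R.
  by rewrite -!pmulrn natrD !natrM.
by move: W_ge; rewrite !mulrDl mulNr; lra.
Qed.
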